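(* Let $K=-L\Pi^{-1}$ be a rate constant matrix over $V$ with $|V|=n$, let $t_{\max}>0$, and let $\varepsilon\ge0$ be an error tolerance. The running time of the algorithm RelaxedStableLazyFastGreedy is $$\Theta\big(M_{\mathrm{offdiag}}+M_{\mathrm{diag}}+\mathrm{nnz}(K)\big)+O\Big(\sum_{j=1}^{k+1}j\,c_j\log n\Big),$$ which boils down to (1) $\Theta(k^3+\mathrm{nnz}(K))+O(k^2\log n)$ if the lazy heuristic works the best; (2) $\Theta(k^2n+\mathrm{nnz}(K))+O(k^2n\log n)$ if the lazy and relaxing heuristics work the worst and the best, respectively; (3) $\Theta(k^3n+\mathrm{nnz}(K))+O(k^2n\log n)$ if both the lazy and relaxing heuristics work the worst.
   Context: Rate constant matrices. $V$ is a finite set with $|V|=n$ (identified with $[n]=\{1,\dots,n\}$). A rate constant matrix over $V$ is $K\in\mathbb{R}^{V\times V}$ with (i) $K_{uv}\ge 0$ for $u\ne v$; (ii) $K_{vv}=-\sum_{u\ne v}K_{uv}$ for all $v$; (iii) there is a positive vector $\pi\in\mathbb{R}^V$ with $K_{uv}\pi_v=K_{vu}\pi_u$ for all $u,v$. Put $\Pi=\mathrm{Diag}(\pi)$ and $L=-K\Pi$, so $K=-L\Pi^{-1}$; $L$ is a graph Laplacian matrix (symmetric, nonpositive off-diagonal entries, zero row sums). $\mathrm{nnz}(K)$ is the number of nonzero entries of $K$; it is assumed that $\mathrm{nnz}(K)=\Omega(n)$. Each arithmetic operation, square root and comparison costs unit time. For a matrix $C$, an index $u$ and a set $J$ of column indices,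 $C_{uJ}$ is the row vector $(C_{ul})_{l\in J}$. LazyFastGreedy. Initialize $j\leftarrow1$, $S^{(0)}=\varnothing$, $T^{(0)}=V$, $d^{(0)}=\mathrm{diag}(L)$, and $b_v\leftarrow0$, $\rho_v\leftarrow d^{(0)}_v/\pi_v$ for $v\in V$. Repeat the following while-iteration: (a) let $u$ maximize $\rho_v$ over $v\in T^{(j-1)}$ (ties broken by a fixed total order; the $\rho_v$ are kept in a binary heap); (b) for $l=b_u+1,\dots,j-1$ compute $C_{ul}=(L_{us^{(l)}}-\langle C_{uJ},C_{s^{(l)}J}\rangle)/C_{s^{(l)}l}$ with $J=[l-1]$; (c) compute $d^{(j-1)}_u=d^{(b_u)}_u-\sum_{l=b_u+1}^{j-1}C_{ul}^2$; (d) set $b_u\leftarrow j-1$, $\rho_u\leftarrow d_u^{(j-1)}/\pi_u$; (e) if $\rho_u\ge\rho_v$ for all $v\in T^{(j-1)}$, set $s^{(j)}=u$; if moreover $\rho_u<1/t_{\max}$, set $k=j-1$ and terminate; otherwise set $S^{(j)}=S^{(j-1)}\cup\{u\}$, $T^{(j)}=T^{(j-1)}\setminus\{u\}$, $C_{uj}=\sqrt{d_u^{(j-1)}}$, and $j\leftarrow j+1$. StableLazyFastGreedy. This is LazyFastGreedy with step (c) replaced by the following procedure StablyComputeDiagonal$(j,u)$. Put $T'=T^{(j-1)}\setminus\{u\}$ and $L^{[j,u]}_{\star v}=\sum_{w\in T'}L_{wv}$ for $v\in S^{(j-1)}\cup\{u\}$. For $l=1,\dots,j-1$ compute ( * ) $C^{[j,u]}_{\star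 l}=\big(L^{[j,u]}_{\star s^{(l)}}-\langle C^{[j,u]}_{\star J},C_{s^{(l)}J}\rangle\big)/C_{s^{(l)}l}$ with $J=[l-1]$; then return ( ** ) $d_u^{(j-1)}=\langle C^{[j,u]}_{\star J},C_{uJ}\rangle-L^{[j,u]}_{\star u}$ with $J=[j-1]$. Segment trees. For each $v\in V$ a segment tree $\mathcal T_v$ over a semigroup (same-sign reals under addition) stores the nonzero off-diagonal entries of the $v$th column of $L$; initialization takes time linear in the number of stored entries, and the query for the sum over a range of consecutive positions and the update of one entry take $O(\log n)$ time each. Whenever $b_u$ is updated in step (d) from $b_u^{\mathrm{old}}$ to $j-1$, the entries of $\mathcal T_u$ at $s^{(l)}$, $l=b_u^{\mathrm{old}}+1,\dots,j-1$, are set to $0$; whenever an element $s$ is removed from $T^{(j-1)}$, the entry at $s$ of $\mathcal T_v$ is set to $0$ for all $v\in S^{(j-1)}$. Each value $L^{[j,u]}_{\star v}$ is obtained by two sum queries on $\mathcal T_v$ (positions before $u$ and positions after $u$). RelaxedStableLazyFastGreedy. This is StableLazyFastGreedy in which ( * ) is replaced, whenever $C_{ul}/C_{\star l}^{[j-1,s^{(j-1)}]}\le\varepsilon/(2+\varepsilon)$, by the constant-time computation $C_{\star l}^{[j,u]}=C_{\star l}^{[j-1,s^{(j-1)}]}-C_{ul}$ (no inner product is computed); otherwise ( * ) is used. Counters. $b_v$ denotes the value at termination. $c_j$ ($j\in[k+1]$) is the number of while-iterations performed with index $j$. $M_{\mathrm{offdiag}}=\frac12\sum_{v\in V}b_v(b_v-1)$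 is the total dimension of the vectors whose inner products are computed in step (b). $M_{\mathrm{diag}}$ is the total dimension of the vectors whose inner products are actually computed in ( * ) and ( ** ) over all calls of StablyComputeDiagonal. ''The lazy heuristic works the best'' means that $c_j=1$ for all $j\in[k+1]$ (so $b_v=0$ for $v\in T^{(k)}\setminus\{s^{(k+1)}\}$); ''works the worst'' means that $c_1=1$, $c_j=n-j+1$ for $2\le j\le k+1$, and $b_v=k$ for all $v\in T^{(k)}$. In all cases $b_{s^{(j)}}=j-1$ for $j\in[k+1]$. ''The relaxing heuristic works the best'' means that no inner product is ever computed in ( * ); ''works the worst'' means that the inner product in ( * ) is computed every time. *)

(* Defs.v *)
From HB Require Import structures.
From mathcomp Require Import all_boot all_order all_algebra.
From mathcomp Require Import reals exp.

Set Implicit Arguments.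
Unset Strict Implicit.
Unset Printing Implicit Defensive.

Import Order.TTheory GRing.Theory Num.Theory.

Local Open Scope ring_scope.

(* A value together with the number of unit-cost operations spent on it.
   [tick] is only applied to a single arithmetic operation, square root or
   comparison; reading, writing and sharing data is free. *)
Definition timed (A : Type) : Type := (A * nat)%type.

Definition ret (A : Type) (x : A) : timed A := (x, 0%N).

Definition tick (A : Type) (x : A) : timed A := (x, 1%N).

Definition bind (A B : Type) (m : timed A) (f : A -> timed B) : timed B :=
  let: (x, s) := m in let: (y, t) := f x in (y, (s + t)%N).

Notation "'let*' x ':=' m 'in' f" := (bind m (fun x => f))
  (at level 200, x name, m at level 200, f at level 200, right associativity).

Fixpoint mapM (A B : Type) (f : A -> timed B) (s : seq A) : timed (seq B) :=
  if s is x :: s' then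
    let* y := f x in let* ys := mapM f s' in ret (y :: ys)
  else ret [::].

Fixpoint foldM (A B : Type) (f : B -> A -> timed B) (b : B) (s : seq A) :
    timed B :=
  if s is x :: s' then let* b' := f b x in foldM f b' s' else ret b.

(* Vectors of dimension m: 2m operations. *)
Fixpoint dot (R : realType) (x y : seq R) : timed R :=
  match x, y with
  | a :: x', b :: y' =>
      let* p := tick (a * b) in let* q := dot x' y' in tick (p + q)
  | _, _ => ret 0
  end.

Inductive heap (T : Type) : Type :=
| Empty
| Fork of T & heap T & heap T.

Arguments Empty {T}.

Definition heap_root (T : Type) (h : heap T) : option T :=
  if h is Fork x _ _ then Some x else None.

(* The winner among the roots of l and r; the boolean tells whether it is the
   root of l. *)
Definition winner (T : Type) (gt : T -> T -> timed bool) (l r : heap T) :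
    timed (option (bool * T)) :=
  match heap_root l, heap_root r with
  | None, None => ret None
  | Some y, None => ret (Some (true, y))
  | None, Some z => ret (Some (false, z))
  | Some y, Some z =>
      let* b := gt y z in ret (Some (if b then (true, y) else (false, z)))
  end.

(* Replaces the root of h by x and restores the heap order. *)
Fixpoint sift_down (T : Type) (gt : T -> T -> timed bool) (x : T)
    (h : heap T) : timed (heap T) :=
  if h is Fork _ l r then
    let* w := winner gt l r in
    if w is Some (is_l, y) then
      let* b := gt y x in
      if ~~ b then ret (Fork x l r)
      else if is_l then let* l' := sift_down gt x l in ret (Fork y l' r)
      else let* r' := sift_down gt x r in ret (Fork y l r')
    else ret (Fork x l r)
  else ret Empty.

Fixpoint pop (T : Type) (gt : T -> T -> timed bool) (h : heap T) :
    timed (heap T) :=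
  if h is Fork _ l r then
    let* w := winner gt l r in
    if w is Some (is_l, y) then
      if is_l then let* l' := pop gt l in ret (Fork y l' r)
      else let* r' := pop gt r in ret (Fork y l r')
    else ret Empty
  else ret Empty.

(* Linear-time construction, to be called with fuel >= size s. *)
Fixpoint heapify (T : Type) (gt : T -> T -> timed bool) (fuel : nat)
    (s : seq T) : timed (heap T) :=
  match fuel, s with
  | fuel'.+1, x :: s' =>
      let m := (size s')./2 in
      let* l := heapify gt fuel' (take m s') in
      let* r := heapify gt fuel' (drop m s') in
      sift_down gt x (Fork x l r)
  | _, _ => ret Empty
  end.

(* [SNode lo hi x l r] covers the stored positions between lo and hi, whose
   entries sum up to x. *)
Inductive segtree (R : Type) : Type :=
| SNil
| SLeaf of nat & R
| SNode of nat & nat & R & segtree R & segtree R.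

Arguments SNil {R}.

Definition segtree_total (R : realType) (t : segtree R) : R :=
  match t with SNil => 0 | SLeaf _ x => x | SNode _ _ x _ _ => x end.

Definition first_pos (R : realType) (t : segtree R) : nat :=
  match t with SNil => 0%N | SLeaf p _ => p | SNode lo _ _ _ _ => lo end.

Definition last_pos (R : realType) (t : segtree R) : nat :=
  match t with SNil => 0%N | SLeaf p _ => p | SNode _ hi _ _ _ => hi end.

(* s lists the stored (position, entry) pairs by increasing position; to be
   called with fuel >= size s. *)
Fixpoint segtree_init (R : realType) (fuel : nat) (s : seq (nat * R)) :
    timed (segtree R) :=
  match fuel, s with
  | _, [:: (p, x)] => ret (SLeaf p x)
  | fuel'.+1, _ :: _ =>
      let m := (size s)./2 in
      let* l := segtree_init fuel' (take m s) in
      let* r := segtree_init fuel' (drop m s) in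
      let* x := tick (segtree_total l + segtree_total r) in
      ret (SNode (first_pos l) (last_pos r) x l r)
  | _, _ => ret SNil
  end.

(* Sum of the entries at the positions p with a <= p < b. *)
Fixpoint segtree_query (R : realType) (a b : nat) (t : segtree R) : timed R :=
  match t with
  | SNil => ret 0
  | SLeaf p x =>
      let* c1 := tick (a <= p)%N in
      let* c2 := tick (p < b)%N in
      ret (if c1 && c2 then x else 0)
  | SNode lo hi x l r =>
      let* out1 := tick (hi < a)%N in
      let* out2 := tick (b <= lo)%N in
      if out1 || out2 then ret 0
      else
        let* in1 := tick (a <= lo)%N in
        let* in2 := tick (hi < b)%N in
        if in1 && in2 then ret x
        else
          let* y := segtree_query a b l in
          let* z := segtree_query a b r in
          tick (y + z)
  end.

(* Sets the entry at position p, if it is stored, to y. *)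
Fixpoint segtree_update (R : realType) (p : nat) (y : R) (t : segtree R) :
    timed (segtree R) :=
  match t with
  | SNil => ret SNil
  | SLeaf q x =>
      let* c := tick (p == q) in ret (SLeaf q (if c then y else x))
  | SNode lo hi _ l r =>
      let* c := tick (p <= last_pos l)%N in
      if c then
        let* l' := segtree_update p y l in
        let* x := tick (segtree_total l' + segtree_total r) in
        ret (SNode lo hi x l' r)
      else
        let* r' := segtree_update p y r in
        let* x := tick (segtree_total l + segtree_total r') in
        ret (SNode lo hi x l r')
  end.

Definition rate_constant_matrix (R : realType) (n : nat) (K : 'M[R]_n)
    (pi : 'rV[R]_n) : Prop :=
  [/\ forall u v, u != v -> 0 <= K u v,
      forall v, K v v = - \sum_(u | u != v) K u v,
      forall v, 0 < pi 0 v
    & forall u v, K u v * pi 0 v = K v u * pi 0 u].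

Definition nnz (R : realType) (m n : nat) (A : 'M[R]_(m, n)) : nat :=
  #|[set e : 'I_m * 'I_n | A e.1 e.2 != 0]|.

(* weight is pi, tol is epsilon and tie is the total order that breaks ties in
   step (a). *)
Record problem (R : realType) : Type := Problem {
  nvert : nat;
  rate : 'M[R]_nvert;
  weight : 'rV[R]_nvert;
  tmax : R;
  tol : R;
  tie : rel 'I_nvert
}.

Definition valid (R : realType) (p : problem R) : Prop :=
  [/\ (0 < nvert p)%N,
      rate_constant_matrix (rate p) (weight p),
      0 < tmax p,
      0 <= tol p
    & [/\ reflexive (@tie R p), antisymmetric (@tie R p),
          transitive (@tie R p) & total (@tie R p)]].

(* One while-iteration, with index j and examined element u.  The l-th boolean
   (counted from 0) tells whether C_{*,l+1}^{[j,u]} was obtained by the relaxed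
   constant-time formula; otherwise an inner product of dimension l was
   computed for it. *)
Record iteration_record (n : nat) : Type := IterationRecord {
  it_index : nat;
  it_vertex : 'I_n;
  it_relaxed : seq bool
}.

(* State at the beginning of an iteration of index j:
   - chosen = [:: s^(1); ...; s^(j-1)];
   - queue contains the elements of T^(j-1), ordered by rho;
   - crow v contains the computed entries C_{v1}, C_{v2}, ... of C;
   - cstar = [:: C_{*1}^{[j-1,s]}; ...; C_{*(j-1)}^{[j-1,s]}], s = s^(j-1);
   - history is a ghost field that only serves to define the counters. *)
Record state (R : realType) (n : nat) : Type := State {
  chosen : seq 'I_n;
  queue : heap 'I_n;
  rho : 'I_n -> R;
  ncomputed : 'I_n -> nat;
  crow : 'I_n -> seq R;
  cstar : seq R;
  tree : 'I_n -> segtree R;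
  history : seq (iteration_record n)
}.

Definition precedes (R : realType) (n : nat) (tie : rel 'I_n) (rho : 'I_n -> R)
    (u v : 'I_n) : timed bool :=
  let* e := tick (rho u == rho v) in
  if e then tick (tie u v) else tick (rho v < rho u).

(* Sparse columns: the nonzero entries with their row indices. *)
Definition entry (R : realType) (n : nat) (cols : seq (seq ('I_n * R)))
    (u v : 'I_n) : R :=
  let col := nth [::] cols v in nth 0 (unzip2 col) (index u (unzip1 col)).

(* Returns L = - K Pi and the initial state.  The list of positions of the
   nonzero entries of each column of K is part of the input. *)
Definition initialize (R : realType) (p : problem R) :
    timed (('I_(nvert p) -> 'I_(nvert p) -> R) * state R (nvert p)) :=
  let n := nvert p in
  let V := enum 'I_n in
  let* cols := mapM (fun v =>
    mapM (fun u => let* x := tick (rate p u v * weight p 0 v) in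
                   let* y := tick (- x) in
                   ret (u, y))
      [seq u <- V | rate p u v != 0]) V in
  let* trees := mapM (fun v =>
    let s := [seq (val e.1, e.2) | e <- nth [::] cols (val v) & e.1 != v] in
    segtree_init (size s) s) V in
  let* rhos := mapM (fun v => tick (entry cols v v / weight p 0 v)) V in
  let rho0 := fun v : 'I_n => nth 0 rhos v in
  let* h := heapify (precedes (@tie R p) rho0) n V in
  ret (entry cols,
       State [::] h rho0 (fun=> 0%N) (fun=> [::]) [::]
         (fun v => nth SNil trees v) [::]).

Definition upd (A : Type) (n : nat) (f : 'I_n -> A) (u : 'I_n) (x : A) :
    'I_n -> A :=
  fun v => if v == u then x else f v.

(* Step (b): news = [:: s^(b_u+1); ...; s^(j-1)]. *)
Definition extend_row (R : realType) (n : nat) (L : 'I_n -> 'I_n -> R)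
    (crow : 'I_n -> seq R) (u : 'I_n) (news : seq 'I_n) : timed (seq R) :=
  foldM (fun c s =>
    let* ip := dot c (take (size c) (crow s)) in
    let* x := tick (L u s - ip) in
    let* y := tick (x / nth 0 (crow s) (size c)) in
    ret (rcons c y)) (crow u) news.

(* L_{*v}^{[j,u]}, where t is the segment tree of v. *)
Definition star_sum (R : realType) (n : nat) (u : 'I_n) (t : segtree R) :
    timed R :=
  let* x := segtree_query 0 u t in
  let* y := segtree_query u.+1 n t in
  tick (x + y).

(* Relaxed StablyComputeDiagonal(j, u), where cu = (C_{u1}, ..., C_{u(j-1)}).
   Returns d_u^{(j-1)}, (C_{*l}^{[j,u]})_{l < j} and the kind of formula used
   for each l < j. *)
Definition stably_compute_diagonal (R : realType) (n : nat) (tol : R)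
    (chosen : seq 'I_n) (crow : 'I_n -> seq R) (cstar : seq R)
    (tree : 'I_n -> segtree R) (u : 'I_n) (cu : seq R) :
    timed (R * seq R * seq bool) :=
  let* Lchosen := mapM (fun v => star_sum u (tree v)) chosen in
  let* Lu := star_sum u (tree u) in
  let* e := tick (2 + tol) in
  let* threshold := tick (tol / e) in
  let* res := foldM (fun acc sL =>
    let: (c, kinds) := acc in
    let: (s, Ls) := sL in
    let l := size c in
    let* q := tick (nth 0 cu l / nth 0 cstar l) in
    let* relaxed := tick (q <= threshold) in
    let* y :=
      if relaxed then tick (nth 0 cstar l - nth 0 cu l)
      else
        let* ip := dot c (take l (crow s)) in
        let* x := tick (Ls - ip) in
        tick (x / nth 0 (crow s) l) in
    ret (rcons c y, rcons kinds relaxed)) ([::], [::]) (zip chosen Lchosen) in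
  let: (c, kinds) := res in
  let* ip := dot c cu in
  let* d := tick (ip - Lu) in
  ret (d, c, kinds).

Definition at_least (R : realType) (n : nat) (rho : 'I_n -> R) (x : R)
    (o : option 'I_n) : timed bool :=
  if o is Some v then tick (rho v <= x) else ret true.

(* A while-iteration started with queue st = Fork u l r; the boolean of the
   result tells whether the algorithm terminates.  As u stays at the root while
   its key is modified, the test of step (e) amounts to a comparison with the
   roots of l and r, and the heap is repaired after that test.  The entries of
   the segment tree of u at the elements s^(b_u+1), ..., s^(j-1) are cleared
   before the queries on it.  When u is selected, the value
   C_{*j}^{[j,u]} = (L_{*u} - <C_{*J}, C_{uJ}>) / C_{uj} = - C_{uj} is appended
   to C_*, because it is referred to in the next round. *)
Definition iteration (R : realType) (p : problem R)
    (L : 'I_(nvert p) -> 'I_(nvert p) -> R) (st : state R (nvert p))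
    (u : 'I_(nvert p)) (l r : heap 'I_(nvert p)) :
    timed (bool * state R (nvert p)) :=
  let j := (size (chosen st)).+1 in
  let news := drop (ncomputed st u) (chosen st) in
  let* cu := extend_row L (crow st) u news in
  let* tu := foldM (fun t (s : 'I_(nvert p)) => segtree_update s 0 t)
               (tree st u) news in
  let tree1 := upd (tree st) u tu in
  let* res := stably_compute_diagonal (tol p) (chosen st) (crow st) (cstar st)
                tree1 u cu in
  let: (d, c, kinds) := res in
  let* rho_u := tick (d / weight p 0 u) in
  let rho1 := upd (rho st) u rho_u in
  let ncomputed1 := upd (ncomputed st) u j.-1 in
  let history1 := rcons (history st) (IterationRecord j u kinds) in
  let* okl := at_least rho1 rho_u (heap_root l) in
  let* okr := at_least rho1 rho_u (heap_root r) in
  if okl && okr then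
    let* x := tick (1 / tmax p) in
    let* small := tick (rho_u < x) in
    if small then
      ret (true, State (chosen st) (queue st) rho1 ncomputed1
                   (upd (crow st) u cu) (cstar st) tree1 history1)
    else
      let* cuj := tick (Num.sqrt d) in
      let* h := pop (precedes (@tie R p) rho1) (Fork u l r) in
      let* tree2 := foldM (fun (tr : 'I_(nvert p) -> segtree R) v =>
                       let* t := segtree_update u 0 (tr v) in
                       ret (upd tr v t)) tree1 (chosen st) in
      let* m := tick (- cuj) in
      ret (false, State (rcons (chosen st) u) h rho1 ncomputed1
                    (upd (crow st) u (rcons cu cuj)) (rcons c m)
                    tree2 history1)
  else
    let* h := sift_down (precedes (@tie R p) rho1) u (Fork u l r) in
    ret (false, State (chosen st) h rho1 ncomputed1
                  (upd (crow st) u cu) (cstar st) tree1 history1).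

Inductive loop (R : realType) (p : problem R)
    (L : 'I_(nvert p) -> 'I_(nvert p) -> R) :
    state R (nvert p) -> state R (nvert p) -> nat -> Prop :=
| loop_stop st u l r st' t of
    queue st = Fork u l r &
    iteration L st u l r = (true, st', t) : loop L st st' t
| loop_next st u l r st' t st'' t' of
    queue st = Fork u l r &
    iteration L st u l r = (false, st', t) &
    loop L st' st'' t' : loop L st st'' (t + t')%N.

(* The algorithm terminates on p in state st after t operations. *)
Definition executes (R : realType) (p : problem R) (st : state R (nvert p))
    (t : nat) : Prop :=
  exists L st0 t0 t1,
    [/\ initialize p = (L, st0, t0), loop L st0 st t1 & t = (t0 + t1)%N].

Definition steps (R : realType) (n : nat) (st : state R n) : nat :=
  size (chosen st).

Definition num_iterations (R : realType) (n : nat) (st : state R n) (j : nat) :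
    nat :=
  count (fun it => it_index it == j) (history st).

Definition M_offdiag (R : realType) (n : nat) (st : state R n) : R :=
  (\sum_(v < n) ncomputed st v * (ncomputed st v).-1)%N%:R / 2.

Definition M_diag (R : realType) (n : nat) (st : state R n) : nat :=
  (\sum_(it <- history st)
     (\sum_(l < (it_index it).-1 | ~~ nth false (it_relaxed it) l) l
      + (it_index it).-1))%N.

Definition lazy_best (R : realType) (n : nat) (st : state R n) : Prop :=
  forall j, (1 <= j <= (steps st).+1)%N -> num_iterations st j = 1%N.

Definition lazy_worst (R : realType) (n : nat) (st : state R n) : Prop :=
  [/\ num_iterations st 1 = 1%N,
      forall j, (2 <= j <= (steps st).+1)%N ->
        num_iterations st j = (n - j + 1)%N
    & forall v, v \notin chosen st -> ncomputed st v = steps st].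

Definition relax_best (R : realType) (n : nat) (st : state R n) : bool :=
  all (fun it => all id (it_relaxed it)) (history st).

Definition relax_worst (R : realType) (n : nat) (st : state R n) : bool :=
  all (fun it => all negb (it_relaxed it)) (history st).

Record execution (R : realType) : Type := Execution {
  input : problem R;
  final : state R (nvert input);
  time : nat
}.

(* Terminating executions on inputs with nnz(K) >= c0 n. *)
Definition admissible (R : realType) (c0 : R) (e : execution R) : Prop :=
  [/\ valid (input e), executes (final e) (time e)
    & c0 * (nvert (input e))%:R <= (nnz (rate (input e)))%:R].

(* T = Theta(f) + O(g) with constants that are uniform over the instances that
   satisfy P; both summands are parts of a running time, hence nonnegative. *)
Definition Theta_plus_O (R : realType) (I : Type) (P : I -> Prop)
    (T f g : I -> R) : Prop :=
  exists X Y : I -> R,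
    [/\ exists a b : R, [/\ 0 < a, 0 < b &
          forall i, P i -> a * f i <= X i <= b * f i],
        exists2 c : R, 0 < c & forall i, P i -> 0 <= Y i <= c * g i
      & forall i, P i -> T i = X i + Y i].

Definition running_time (R : realType) (e : execution R) : R := (time e)%:R.

Definition k_of (R : realType) (e : execution R) : R := (steps (final e))%:R.

Definition n_of (R : realType) (e : execution R) : R := (nvert (input e))%:R.

Definition nnz_of (R : realType) (e : execution R) : R :=
  (nnz (rate (input e)))%:R.

(* Main.v *)
Require Import Defs.
From mathcomp Require Import all_boot all_order all_algebra.
From mathcomp Require Import reals exp boolp.
From mathcomp Require Import zify ring lra.

Import Order.TTheory GRing.Theory Num.Theory.

Local Open Scope ring_scope.

Set Implicit Arguments.
Unset Strict Implicit.
Unset Printing Implicit Defensive.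

(** The proof has two parts that hardly interact.

    Running time.  An inner product of dimension d costs 2 d operations, so up
    to an overhead every iteration costs exactly twice the amount by which it
    raises M_offdiag + M_diag.  The overhead of an iteration of index j is
    O(j log n): it consists of O(j) scalar operations, O(j) one-sided queries
    and updates of segment trees of depth O(log n), and one repair of a heap of
    height O(log n).  [iteration_shape] states this as a potential argument
    that needs to know only the sizes of the stored rows, trees and heap, never
    their entries; [loop_cost] adds up the iterations.  The initialization
    costs 2 nnz(K) for the entries of L and O(nnz(K) + n) for the trees and the
    heap, and n is absorbed by nnz(K) because nnz(K) >= c0 n.  Hence
    [admissible_bounds]: the running time is at least twice the three counters
    and at most a multiple of them plus O(log n) times the sum of the indices
    of all iterations.  In the three special cases the numbers c_j are known,
    so that the counters become sums of polynomials in j, which are evaluated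
    in closed form.  A lower bound a f <= T and an upper bound
    T <= b f + c g are together equivalent to T = Theta(f) + O(g).

    Termination.  Here the computed numbers matter.  L is symmetric with zero
    column sums, and both properties are inherited by its Schur complements.
    Therefore the diagonal entry of a Schur complement is minus the sum of the
    other entries of its column, which is what the stable procedure evaluates
    from the column sums of the Cholesky factor; the relaxed formula removes
    one term from such a sum and is exact, too ([star_fold_val]).  So all
    stored quantities are those of exact Cholesky factorization
    ([refresh_exact], [selected_exact]).  If a vertex is examined twice with
    the same index, the second examination reproduces its key; as it is the
    root of the heap, it passes the test of step (e).  Thus only finitely many iterations share
    an index.  Finally the last remaining vertex has key 0 < 1 / t_max, so the
    queue is never exhausted ([loop_exists]). *)

(** * Costs of the basic operations *)

Arguments bind : simpl never.

Lemma bindE A B (m : timed A) (f : A -> timed B) :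
  bind m f = ((f m.1).1, (m.2 + (f m.1).2)%N).
Proof. by rewrite /bind; case: m => x s /=; case: (f x). Qed.

Lemma mapM_val A B (f : A -> timed B) s :
  (mapM f s).1 = [seq (f x).1 | x <- s].
Proof. by elim: s => //= x s <-; rewrite !bindE. Qed.

Lemma mapM_time A B (f : A -> timed B) s :
  (mapM f s).2 = (\sum_(x <- s) (f x).2)%N.
Proof.
elim: s => [|x s IH]; first by rewrite big_nil.
by rewrite big_cons -IH /= !bindE /= addn0.
Qed.

Lemma dot_time (R : realType) (x y : seq R) :
  (dot x y).2 = (2 * minn (size x) (size y))%N.
Proof.
elim: x y => [|a x IH] [|b y] //=; rewrite ?minn0 ?min0n //.
by rewrite !bindE /= IH minnSS; lia.
Qed.

Lemma dot_val (R : realType) (x y : seq R) : size x = size y ->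
  (dot x y).1 = \sum_(i < size x) x`_i * y`_i.
Proof.
elim: x y => [|a x IH] [|b y] //=; first by rewrite big_ord0.
by case=> /IH E; rewrite !bindE /= E big_ord_recl.
Qed.

(** * Binary heaps *)

Section Heap.
Variables (T : eqType) (d : Order.disp_t) (K : orderType d) (key : T -> K).
Variable gt : T -> T -> timed bool.
Hypothesis gt_time : forall x y, ((gt x y).2 <= 2)%N.
Hypothesis gt_val : forall x y,
  if (gt x y).1 then (key y <= key x)%O else (key x <= key y)%O.
Implicit Types (x y z : T) (h l r : heap T).

Fixpoint heap_elems h : seq T :=
  if h is Fork x l r then x :: heap_elems l ++ heap_elems r else [::].

Fixpoint height h : nat :=
  if h is Fork _ l r then (maxn (height l) (height r)).+1 else 0.

Definition root_below (b : K) h : bool :=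
  if heap_root h is Some y then (key y <= b)%O else true.

Fixpoint heap_ordered h : bool :=
  if h is Fork x l r then
    [&& root_below (key x) l, root_below (key x) r, heap_ordered l
      & heap_ordered r]
  else true.

Variant winner_spec l r : timed (option (bool * T)) -> Prop :=
| WinnerNone of l = Empty & r = Empty : winner_spec l r (None, 0%N)
| WinnerLeft y a b t of l = Fork y a b & (t <= 2)%N & root_below (key y) r :
    winner_spec l r (Some (true, y), t)
| WinnerRight z a b t of r = Fork z a b & (t <= 2)%N & root_below (key z) l :
    winner_spec l r (Some (false, z), t).

Lemma winnerP l r : winner_spec l r (winner gt l r).
Proof.
rewrite /winner.
case: l => [|y a b]; case: r => [|z a' b'] /=.
- exact: WinnerNone.
- exact: (WinnerRight (a := a') (b := b')).
- exact: (WinnerLeft (a := a) (b := b)).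
- rewrite bindE /=; move: (gt_time y z) (gt_val y z).
  case: (gt y z) => [[] t] /=; rewrite addn0 => tle le.
  + exact: (WinnerLeft (a := a) (b := b)).
  + exact: (WinnerRight (a := a') (b := b')).
Qed.

Lemma sift_down_time x h : ((sift_down gt x h).2 <= 4 * height h)%N.
Proof.
elim: h x => //= y l IHl r IHr x; rewrite !bindE /=.
case: winnerP => [_ _|z a b t _ t2 _|z a b t _ t2 _] //=;
  rewrite !bindE /=; move: (gt_time z x); case: (gt z x).1 => /=;
  rewrite ?bindE /=; move: (IHl x) (IHr x); lia.
Qed.

Lemma sift_down_height x h : (height (sift_down gt x h).1 <= height h)%N.
Proof.
elim: h x => //= y l IHl r IHr x; rewrite !bindE /=.
case: winnerP => [_ _|z a b t _ t2 _|z a b t _ t2 _] //=;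
  rewrite !bindE /=; case: (gt z x).1 => //=;
  rewrite ?bindE /=; move: (IHl x) (IHr x); lia.
Qed.

Lemma sift_down_elems x y l r :
  perm_eq (heap_elems (sift_down gt x (Fork y l r)).1)
          (x :: heap_elems l ++ heap_elems r).
Proof.
set h := Fork y l r; have -> : x :: heap_elems l ++ heap_elems r =
  if h is Fork _ l r then x :: heap_elems l ++ heap_elems r else [::] by [].
elim: {l r y} h x => //= y l IHl r IHr x; rewrite !bindE /=.
case: winnerP => [_ _|z a b t E t2 _|z a b t E t2 _] //=;
  rewrite !bindE /=; case: (gt z x).1 => //=; rewrite ?bindE /=.
- move: (IHl x); rewrite E /= => P.
  apply: (perm_trans (y := z :: (x :: heap_elems a ++ heap_elems b) ++ heap_elems r)).
    by rewrite perm_cons perm_cat2r.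
  by apply/permP => q /=; lia.
- move: (IHr x); rewrite E /= => P.
  apply: (perm_trans (y := z :: heap_elems l ++ (x :: heap_elems a ++ heap_elems b))).
    by rewrite perm_cons perm_cat2l.
  by apply/permP => q; rewrite /= !count_cat /= !count_cat; lia.
Qed.

Lemma root_below_trans b b' h : (b <= b')%O -> root_below b h -> root_below b' h.
Proof. by case: h => //= y l r bb'; rewrite /root_below /= => /le_trans ->. Qed.

(** The second conclusion only serves the induction: the root of the repaired
    subheap must not exceed the key that was moved above it. *)
Lemma sift_down_ordered x y l r : heap_ordered l -> heap_ordered r ->
  heap_ordered (sift_down gt x (Fork y l r)).1 /\
  (forall b, (key x <= b)%O -> root_below b l -> root_below b r ->
     root_below b (sift_down gt x (Fork y l r)).1).
Proof.
set h := Fork y l r => ol or.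
have : if h is Fork _ l r then heap_ordered l && heap_ordered r else true.
  by rewrite /= ol or.
suff: if h is Fork _ l r then heap_ordered l && heap_ordered r ->
   heap_ordered (sift_down gt x h).1 /\
  (forall b, (key x <= b)%O -> root_below b l -> root_below b r ->
     root_below b (sift_down gt x h).1) else True by [].
elim: {y l r ol or} h x => //= y l IHl r IHr x /andP[ol or]; rewrite !bindE /=.
case: winnerP => [-> -> /=|z a b t E t2 zr|z a b t E t2 zl].
  by split=> // b xb _ _; rewrite /root_below.
all: rewrite /= !bindE /=; move: (gt_val z x); case: (gt z x).1 => //= zx.
- move: (IHl x) ol; rewrite E /= => IH /and4P[za zb oa ob].
  case: IH; first by rewrite oa.
  by move=> o bel; rewrite or o zr bel.
- by rewrite or ol E (root_below_trans zx zr) /root_below /= zx; split.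
- move: (IHr x) or; rewrite E /= => IH /and4P[za zb oa ob].
  case: IH; first by rewrite oa.
  by move=> o bel; rewrite ol o zl bel.
- by rewrite or ol E (root_below_trans zx zl) /root_below /= zx; split.
Qed.

Lemma pop_time h : ((pop gt h).2 <= 2 * height h)%N.
Proof.
elim: h => //= y l IHl r IHr; rewrite !bindE /=.
by case: winnerP => [_ _|z a b t _ t2 _|z a b t _ t2 _] //=;
  rewrite !bindE /=; lia.
Qed.

Lemma pop_height h : (height (pop gt h).1 <= height h)%N.
Proof.
elim: h => //= y l IHl r IHr; rewrite !bindE /=.
by case: winnerP => [_ _|z a b t _ t2 _|z a b t _ t2 _] //=;
  rewrite !bindE /=; lia.
Qed.

Lemma pop_elems x l r :
  perm_eq (heap_elems (pop gt (Fork x l r)).1) (heap_elems l ++ heap_elems r).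
Proof.
rewrite -[X in perm_eq _ X]/(behead (heap_elems (Fork x l r))).
elim: (Fork x l r) => //= y {}l IHl {}r IHr; rewrite !bindE /=.
case: winnerP => [-> -> //|z a b t E t2 _|z a b t E t2 _] //=;
  rewrite !bindE /=.
- by move: IHl; rewrite E /= => IH; rewrite perm_cons perm_cat2r.
- move: IHr; rewrite E /= => IH.
  apply: (perm_trans (y := z :: heap_elems l ++ heap_elems a ++ heap_elems b)).
    by rewrite perm_cons perm_cat2l.
  by apply/permP => q; rewrite /= !count_cat /= count_cat; lia.
Qed.

Lemma pop_below b h : heap_ordered h -> root_below b h ->
  root_below b (pop gt h).1.
Proof.
case: h => //= y l r /and4P[yl yr _ _] yb; rewrite !bindE /=.
case: winnerP => [_ _ //|z a c t E t2 _|z a c t E t2 _] //=;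
  rewrite !bindE /=; [move: yl|move: yr]; rewrite E /root_below /= => /le_trans;
  exact.
Qed.

Lemma pop_ordered h : heap_ordered h -> heap_ordered (pop gt h).1.
Proof.
elim: h => //= y l IHl r IHr /and4P[yl yr ol or]; rewrite !bindE /=.
case: winnerP => [_ _|z a b t E t2 zr|z a b t E t2 zl] //=; rewrite !bindE /=.
- rewrite zr (IHl ol) or /= andbT pop_below //.
  by rewrite E /root_below /=.
- rewrite zl (IHr or) ol /= andbT pop_below //.
  by rewrite E /root_below /=.
Qed.

Lemma up_log2_half m : (0 < m)%N -> up_log 2 m.+1 = (up_log 2 m./2.+1).+1.
Proof. by move=> m0; rewrite up_log2S //= uphalfE. Qed.

(** The cost is linear although a repair costs up to four times the height: the
    term 4 * up_log 2 _ in the bound is a reserve.  Two subheaps whose sizes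
    differ by at most one have almost the same height, so the reserve of one of
    them pays for the repair at the common root, and the other one is handed
    on. *)
Lemma heapify_spec fuel (s : seq T) : (size s <= fuel)%N ->
  [/\ perm_eq (heap_elems (heapify gt fuel s).1) s,
      (height (heapify gt fuel s).1 <= up_log 2 (size s).+1)%N,
      heap_ordered (heapify gt fuel s).1
    & ((heapify gt fuel s).2 + 4 * up_log 2 (size s).+1 <= 12 * size s)%N].
Proof.
elim: fuel s => [|fuel IH] [|x s] //= le; try by rewrite /= up_log1.
pose s1 := take (size s)./2 s; pose s2 := drop (size s)./2 s.
pose l := (heapify gt fuel s1).1; pose r := (heapify gt fuel s2).1.
have -> : (let* l := heapify gt fuel s1 in let* r := heapify gt fuel s2 in
           sift_down gt x (Fork x l r)) =
  ((sift_down gt x (Fork x l r)).1, ((heapify gt fuel s1).2 +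
     ((heapify gt fuel s2).2 + (sift_down gt x (Fork x l r)).2))%N).
  by rewrite !bindE.
have e1 : size s1 = (size s)./2 by rewrite size_takel //; lia.
have e2 : size s2 = (size s - (size s)./2)%N by rewrite size_drop.
have le1 : (size s1 <= fuel)%N by lia.
have le2 : (size s2 <= fuel)%N by lia.
have [p1 h1 o1 t1] := IH s1 le1; have [p2 h2 o2 t2] := IH s2 le2.
have g : up_log 2 (size s).+2 = (up_log 2 (size s2).+1).+1.
  by rewrite up_log2_half //; congr (up_log 2 _).+1; lia.
have g1 : (up_log 2 (size s1).+1 <= up_log 2 (size s2).+1)%N.
  by apply: leq_up_log; lia.
have g2 : (up_log 2 (size s2).+1 <= (up_log 2 (size s1).+1).+1)%N.
  have [->|?] := posnP (size s2); first by rewrite up_log1.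
  by rewrite up_log2_half // ltnS; apply: leq_up_log; lia.
rewrite -/l in p1 h1 o1; rewrite -/r in p2 h2 o2.
have := sift_down_time x (Fork x l r); have := sift_down_height x (Fork x l r).
have := sift_down_elems x x l r; have [+ _] := sift_down_ordered x x o1 o2.
move: (sift_down gt x (Fork x l r)) => sd /= osd psd hsd tsd.
rewrite g; split=> //; try lia.
apply: (perm_trans psd); rewrite perm_cons.
by rewrite -[s in X in perm_eq _ X](cat_take_drop (size s)./2 s) perm_cat.
Qed.

End Heap.

(** * Segment trees *)

Section SegmentTree.
Variable R : realType.
Implicit Types (t l r : segtree R) (a b p q : nat) (x y : R).

Fixpoint seg_at t p : R :=
  match t with
  | SNil => 0
  | SLeaf q x => if p == q then x else 0
  | SNode _ _ _ l r => seg_at l p + seg_at r p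
  end.

Fixpoint depth t : nat :=
  if t is SNode _ _ _ l r then (maxn (depth l) (depth r)).+1 else 0.

Fixpoint seg_wf t : bool :=
  if t is SNode lo hi x l r then
    [&& seg_wf l, seg_wf r, lo == first_pos l, hi == last_pos r,
        (last_pos l < first_pos r)%N & x == segtree_total l + segtree_total r]
  else true.

Lemma seg_wf_pos t : seg_wf t -> (first_pos t <= last_pos t)%N.
Proof.
elim: t => //= lo hi x l IHl r IHr /and5P[/IHl ? /IHr ? /eqP-> /eqP->].
by case/andP => *; lia.
Qed.

Lemma seg_at_out t p : seg_wf t ->
  (p < first_pos t)%N || (last_pos t < p)%N -> seg_at t p = 0.
Proof.
elim: t => //= [q x _|lo hi x l IHl r IHr /and5P[wl wr /eqP-> /eqP->]].
  by case: eqP => // ->; rewrite ltnn.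
case/andP => lr _ out; move: (seg_wf_pos wl) (seg_wf_pos wr) => *.
by rewrite IHl ?IHr ?addr0 //; lia.
Qed.

Lemma segtree_total_sum n t : seg_wf t -> (last_pos t < n)%N ->
  segtree_total t = \sum_(p < n) seg_at t p.
Proof.
elim: t => [|q x|lo hi x l IHl r IHr] /=; first by rewrite big1.
  move=> _ qn; rewrite (bigD1 (Ordinal qn)) //= eqxx big1 ?addr0 // => i.
  by rewrite -val_eqE /= => /negbTE ->.
case/and5P => [wl wr _ /eqP-> /andP[lr /eqP ->]] rn.
by have ? := seg_wf_pos wr; rewrite IHl ?IHr ?big_split //; lia.
Qed.

Lemma segtree_query_val n a b t : seg_wf t -> (last_pos t < n)%N ->
  (segtree_query a b t).1 = \sum_(p < n | (a <= p < b)%N) seg_at t p.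
Proof.
elim: t => [|q x|lo hi x l IHl r IHr].
- by rewrite big1.
- move=> _ /= qn; rewrite big_mkcond (bigD1 (Ordinal qn)) //= eqxx big1 ?addr0.
    by [].
  by move=> i; rewrite -val_eqE /= => /negbTE ->; rewrite if_same.
move=> w; have := w; rewrite [seg_wf _]/=.
case/and5P => [wl wr /eqP Elo /eqP Ehi /andP[lr /eqP Ex]] hin.
have hi_r : hi = last_pos r := Ehi; rewrite [last_pos _]/= in hin.
have [? ?] := (seg_wf_pos wl, seg_wf_pos wr).
rewrite /= ?bindE /=; case: ifP => [out|/norP[in1 in2]].
  rewrite big1 // => p ab.
  by apply: (seg_at_out (t := SNode lo hi x l r)) => //=; lia.
rewrite ?bindE /=; case: ifP => [/andP[in3 in4]|_] /=.
  have -> : x = segtree_total (SNode lo hi x l r) by [].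
  rewrite (segtree_total_sum (n := n)) // [RHS]big_mkcond /=; apply: eq_bigr => p _.
  case: ifP => // ab.
  by apply: (seg_at_out (t := SNode lo hi x l r)) => //=; lia.
by rewrite ?bindE /= IHl ?IHr ?big_split //; lia.
Qed.

Lemma segtree_query_inside_time a b t :
  (a <= first_pos t)%N -> (last_pos t < b)%N ->
  ((segtree_query a b t).2 <= 4)%N.
Proof.
case: t => [|q x|lo hi x l r] //= alo hib; rewrite ?bindE /= alo hib /=.
by case: ifP.
Qed.

Lemma segtree_query_outside_time a b t :
  (last_pos t < a)%N || (b <= first_pos t)%N -> 
  ((segtree_query a b t).2 <= 2)%N.
Proof. by case: t => [|q x|lo hi x l r] //= out; rewrite ?bindE /= out. Qed.

(** A range that covers one end of the stored positions splits at most one child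
    of every node: if its boundary lies in one half, the other half is entirely
    inside or entirely outside.  So the visited nodes follow a single path. *)
Lemma segtree_query_time a b t : seg_wf t ->
  (a <= first_pos t)%N || (last_pos t < b)%N ->
  ((segtree_query a b t).2 <= 9 * depth t + 4)%N.
Proof.
elim: t => [|q x|lo hi x l IHl r IHr] //.
rewrite [seg_wf _]/=; case/and5P => [wl wr /eqP Elo /eqP Ehi /andP[lr _]] side.
have {}side : (a <= first_pos l)%N || (last_pos r < b)%N by rewrite -Elo -Ehi.
have [? ?] := (seg_wf_pos wl, seg_wf_pos wr).
have children : ((segtree_query a b l).2 + (segtree_query a b r).2
    <= 9 * maxn (depth l) (depth r) + 8)%N.
  have [al|al] := leqP a (first_pos l).
    have [br|br] := leqP b (first_pos r).
      have := @segtree_query_outside_time a b r; rewrite br orbT => /(_ isT).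
      by move: (IHl wl); rewrite al => /(_ isT); lia.
    have := @segtree_query_inside_time a b l al; rewrite (ltn_trans lr br).
    move=> /(_ isT); have ar : (a <= first_pos r)%N by lia.
    by move: (IHr wr); rewrite ar => /(_ isT); lia.
  have br : (last_pos r < b)%N by lia.
  have [la|la] := ltnP (last_pos l) a.
    have := @segtree_query_outside_time a b l; rewrite la => /(_ isT).
    by move: (IHr wr); rewrite br orbT => /(_ isT); lia.
  have ar : (a <= first_pos r)%N by lia.
  have := @segtree_query_inside_time a b r ar br.
  by move: (IHl wl); rewrite (_ : (last_pos l < b)%N) ?orbT; [move=> /(_ isT)|]; lia.
rewrite /= ?bindE /=; case: ifP => _ /=; first by lia.
by rewrite ?bindE /=; case: ifP => _ /=; rewrite ?bindE /=; lia.
Qed.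

Lemma segtree_update_first p y t :
  first_pos (segtree_update p y t).1 = first_pos t.
Proof.
by case: t => //= lo hi x l r; rewrite ?bindE /=; case: ifP; rewrite ?bindE.
Qed.

Lemma segtree_update_last p y t :
  last_pos (segtree_update p y t).1 = last_pos t.
Proof.
by case: t => //= lo hi x l r; rewrite ?bindE /=; case: ifP; rewrite ?bindE.
Qed.

Lemma segtree_update_depth p y t : depth (segtree_update p y t).1 = depth t.
Proof.
elim: t => //= lo hi x l IHl r IHr; rewrite ?bindE /=.
by case: ifP; rewrite ?bindE /= ?IHl ?IHr.
Qed.

Lemma segtree_update_wf p y t : seg_wf t -> seg_wf (segtree_update p y t).1.
Proof.
elim: t => //= lo hi x l IHl r IHr.
case/and5P => [wl wr /eqP Elo /eqP Ehi /andP[lr /eqP Ex]]; rewrite ?bindE /=.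
case: ifP => _; rewrite ?bindE /= !(segtree_update_first, segtree_update_last).
  by rewrite IHl ?wr ?Elo ?Ehi ?lr ?eqxx.
by rewrite IHr ?wl ?Elo ?Ehi ?lr ?eqxx.
Qed.

Lemma segtree_update_time p y t :
  ((segtree_update p y t).2 <= 2 * depth t + 1)%N.
Proof.
elim: t => //= lo hi x l IHl r IHr; rewrite ?bindE /=.
by case: ifP; rewrite ?bindE /=; lia.
Qed.

Lemma segtree_clear_at p t q : seg_wf t ->
  seg_at (segtree_update p 0 t).1 q = if q == p then 0 else seg_at t q.
Proof.
elim: t => [|q' x|lo hi x l IHl r IHr] /=; first by case: ifP.
  rewrite ?bindE /= => _; have [->|pq'] := eqVneq p q'.
    by case: ifP.
  by have [->|//] := eqVneq q p; rewrite (negbTE pq').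
case/and5P => [wl wr _ _ /andP[lr _]]; rewrite ?bindE /=.
case: ifP => ple; rewrite ?bindE /= ?IHl ?IHr //.
  have [->|//] := eqVneq q p; rewrite [seg_at r p]seg_at_out ?add0r //; lia.
have [->|//] := eqVneq q p; rewrite [seg_at l p]seg_at_out ?add0r //; lia.
Qed.

Lemma segtree_init_spec fuel D (s : seq (nat * R)) :
  (size s <= fuel)%N -> (size s <= 2 ^ D)%N -> sorted ltn (unzip1 s) ->
  let t := (segtree_init fuel s).1 in
  [/\ [/\ seg_wf t, first_pos t = head 0%N (unzip1 s)
        & last_pos t = last 0%N (unzip1 s)],
      (depth t <= D)%N, ((segtree_init fuel s).2 <= (size s).-1)%N
    & forall p, seg_at t p = \sum_(e <- s | e.1 == p) e.2].
Proof.
elim: fuel D s => [|fuel IH] D s.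
  by case: s => //= *; split=> // p; rewrite big_nil.
case: s => [|[q x] s] ; first by move=> *; split=> // p; rewrite big_nil.
case: s => [|e' s].
  move=> _ _ _ /=; split=> // p.
  by rewrite big_cons big_nil /= addr0 eq_sym.
have -> : segtree_init fuel.+1 ((q, x) :: e' :: s) =
  let s' := (q, x) :: e' :: s in
  let* l := segtree_init fuel (take (size s')./2 s') in
  let* r := segtree_init fuel (drop (size s')./2 s') in
  let* x := tick (segtree_total l + segtree_total r) in
  ret (SNode (first_pos l) (last_pos r) x l r) by [].
have : (1 < size ((q, x) :: e' :: s))%N by [].
move: ((q, x) :: e' :: s) => {q x e'}s s1 sf sD sorted_s.
case: D => [|D] in sD *; first by lia.
set m := (size s)./2 => /=; rewrite !bindE /=.
rewrite expnS in sD.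
have [size1 size2] : size (take m s) = m /\ size (drop m s) = (size s - m)%N.
  by rewrite size_takel ?size_drop // /m; lia.
have Es : unzip1 s = unzip1 (take m s) ++ unzip1 (drop m s).
  by rewrite /unzip1 -map_cat cat_take_drop.
have sum_s p : \sum_(e <- s | e.1 == p) e.2 =
    \sum_(e <- take m s | e.1 == p) e.2 + \sum_(e <- drop m s | e.1 == p) e.2.
  by rewrite -[s in LHS](cat_take_drop m) big_cat.
have sorted1 : sorted ltn (unzip1 (take m s)) by rewrite /unzip1 map_take take_sorted.
have sorted2 : sorted ltn (unzip1 (drop m s)) by rewrite /unzip1 map_drop drop_sorted.
rewrite Es in sorted_s *.
have [|||[w1 fst1 lst1] d1 t1 a1] := IH D (take m s); rewrite ?size1 //; try by lia.
have [|||[w2 fst2 lst2] d2 t2 a2] := IH D (drop m s); rewrite ?size2 //; try by lia.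
rewrite size1 in t1; rewrite size2 in t2.
move: (segtree_init fuel (take m s)) (segtree_init fuel (drop m s))
  w1 fst1 lst1 d1 t1 a1 w2 fst2 lst2 d2 t2 a2 => l r.
move=> w1 fst1 lst1 d1 t1 a1 w2 fst2 lst2 d2 t2 a2.
have [p1 [u1 Eu1]] : exists p1 u1, unzip1 (take m s) = p1 :: u1.
  by case: (take m s) size1 => [|e u] /= ?; [lia|exists e.1, (unzip1 u)].
have [p2 [u2 Eu2]] : exists p2 u2, unzip1 (drop m s) = p2 :: u2.
  by case: (drop m s) size2 => [|e u] /= ?; [lia|exists e.1, (unzip1 u)].
have lr : (last_pos l.1 < first_pos r.1)%N.
  by move: sorted_s; rewrite lst1 fst2 Eu1 Eu2 /= cat_path /= => /and3P[].
split; rewrite /= ?addn0; try lia.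
- rewrite w1 w2 lr !eqxx; split=> //; first by rewrite fst1 Eu1.
  by rewrite lst2 Eu2 last_cat.
- by move=> p; rewrite sum_s a1 a2.
Qed.

End SegmentTree.

(** * One iteration *)

Section Iteration.
Variables (R : realType) (p : problem R).
Local Notation n := (nvert p).
Variable L : 'I_n -> 'I_n -> R.
Implicit Types (st : state R n) (u v w s : 'I_n) (l r h : heap 'I_n).

(** The steps (b), (c) and (d), up to the test of step (e). *)
Definition refresh st u : timed (state R n * R * seq R) :=
  let news := drop (ncomputed st u) (chosen st) in
  let* cu := extend_row L (crow st) u news in
  let* tu := foldM (fun t (s : 'I_n) => segtree_update s 0 t) (tree st u) news in
  let* res := stably_compute_diagonal (tol p) (chosen st) (crow st) (cstar st)
                (upd (tree st) u tu) u cu in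
  let: (d, c, kinds) := res in
  let* rho_u := tick (d / weight p 0 u) in
  ret (State (chosen st) (queue st) (upd (rho st) u rho_u)
         (upd (ncomputed st) u (size (chosen st))) (upd (crow st) u cu)
         (cstar st) (upd (tree st) u tu)
         (rcons (history st) (IterationRecord (size (chosen st)).+1 u kinds)),
       d, c).

Definition requeued st h : state R n :=
  State (chosen st) h (rho st) (ncomputed st) (crow st) (cstar st) (tree st)
    (history st).

Definition clear_trees (trees : 'I_n -> segtree R) u (vs : seq 'I_n) :=
  foldM (fun (tr : 'I_n -> segtree R) v =>
           let* t := segtree_update u 0 (tr v) in ret (upd tr v t)) trees vs.

Definition selected st u (d : R) (c : seq R) h : state R n :=
  State (rcons (chosen st) u) h (rho st) (ncomputed st)
    (upd (crow st) u (rcons (crow st u) (Num.sqrt d))) (rcons c (- Num.sqrt d))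
    (clear_trees (tree st) u (chosen st)).1 (history st).

Definition heap_gt st := precedes (@tie R p) (rho st).

Lemma precedes_time (rk : 'I_n -> R) u v :
  ((precedes (@tie R p) rk u v).2 <= 2)%N.
Proof. by rewrite /precedes bindE /=; case: ifP. Qed.

Lemma precedes_val (rk : 'I_n -> R) u v :
  if (precedes (@tie R p) rk u v).1 then rk v <= rk u else rk u <= rk v.
Proof.
rewrite /precedes bindE /=; have [->|_] := eqVneq (rk u) (rk v).
  by rewrite /= lexx if_same.
by rewrite /=; case: ltP => // /ltW.
Qed.

Lemma upd_upd (A : Type) (f : 'I_n -> A) u x y :
  upd (upd f u x) u y = upd f u y.
Proof. by apply/funext => v; rewrite /upd; case: (v == u). Qed.

Lemma upd_same (A : Type) (f : 'I_n -> A) u x : upd f u x u = x.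
Proof. by rewrite /upd eqxx. Qed.

Lemma at_leastE (rk : 'I_n -> R) x h :
  at_least rk x (heap_root h) =
  (root_below rk x h, nat_of_bool (isSome (heap_root h))).
Proof. by case: h. Qed.

Variant iteration_spec st1 (d : R) (c : seq R) (t0 : nat) u l r :
  timed (bool * state R n) -> Prop :=
| IterationStop t
    of root_below (rho st1) (rho st1 u) l && root_below (rho st1) (rho st1 u) r
    & rho st1 u < 1 / tmax p & (t0 <= t <= t0 + 4)%N :
    iteration_spec st1 d c t0 u l r ((true, st1), t)
| IterationSelect t
    of root_below (rho st1) (rho st1 u) l && root_below (rho st1) (rho st1 u) r
    & 1 / tmax p <= rho st1 u
    & (t0 <= t <= t0 + 2 * height (Fork u l r)
                  + (clear_trees (tree st1) u (chosen st1)).2 + 6)%N :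
    iteration_spec st1 d c t0 u l r
      ((false, selected st1 u d c (pop (heap_gt st1) (Fork u l r)).1), t)
| IterationRequeue t
    of ~~ (root_below (rho st1) (rho st1 u) l
           && root_below (rho st1) (rho st1 u) r)
    & (t0 <= t <= t0 + 4 * height (Fork u l r) + 2)%N :
    iteration_spec st1 d c t0 u l r
      ((false, requeued st1 (sift_down (heap_gt st1) u (Fork u l r)).1), t).

Local Arguments pop : simpl never.
Local Arguments sift_down : simpl never.

(** An iteration is [refresh] followed by one of three endings.  They leave the
    counters alone and only add the stated overhead. *)
Lemma iterationP st u l r :
  iteration_spec (refresh st u).1.1.1 (refresh st u).1.1.2 (refresh st u).1.2
    (refresh st u).2 u l r (iteration L st u l r).
Proof.
rewrite /refresh /iteration !bindE /=.
set cu := extend_row _ _ _ _; set tu := foldM _ _ _.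
set sd := stably_compute_diagonal _ _ _ _ _ _ _.
case: sd => [[[d c] kinds] ts] /=; rewrite !bindE /= !at_leastE /= ?addn0.
set tr := upd (tree st) u tu.1; set rk := upd (rho st) u _.
have -> : d / weight p 0 u = rk u by rewrite /rk upd_same.
set hist := rcons _ _.
set st1 := State _ _ _ _ _ _ _ _.
have gtt := precedes_time rk; have gtv := precedes_val rk.
have := pop_time gtt gtv (Fork u l r); have := sift_down_time gtt gtv u (Fork u l r).
set t0 := (cu.2 + _)%N => sift_t pop_t.
rewrite -/(clear_trees tr u (chosen st)).
case: ifP => [below|/negbT nbelow].
  case: ltP => [small|large] /=.
    by apply: (@IterationStop st1) => //; rewrite /t0; lia.
  have -> : upd (crow st) u (rcons cu.1 (Num.sqrt d)) =
    upd (crow st1) u (rcons (crow st1 u) (Num.sqrt d)).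
    by rewrite /= upd_upd upd_same.
  by apply: (@IterationSelect st1) => //; move: pop_t; rewrite /t0 /=; lia.
rewrite /=.
by apply: (@IterationRequeue st1) => //; move: sift_t; rewrite /t0 /=; lia.
Qed.

End Iteration.

(** * Dimension counts *)

Section Shape.
Variable R : realType.

Lemma binS2 m : 'C(m.+1, 2) = ('C(m, 2) + m)%N.
Proof. by rewrite binS bin1 addnC. Qed.

Definition rows_sized n (S : seq 'I_n) (rows : 'I_n -> seq R) :=
  forall s, s \in S -> size (rows s) = (index s S).+1.

Lemma rows_sized_next n (S1 S2 : seq 'I_n) s (rows : 'I_n -> seq R) :
  uniq (S1 ++ s :: S2) -> rows_sized (S1 ++ s :: S2) rows ->
  size (rows s) = (size S1).+1.
Proof.
move=> U sized; rewrite sized; last by rewrite mem_cat mem_head orbT.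
rewrite index_cat ifN /= ?eqxx ?addn0 //.
by move: U; rewrite cat_uniq => /and3P[_ /hasPn/(_ s (mem_head _ _))].
Qed.

Lemma extend_row_cost n (L : 'I_n -> 'I_n -> R) rows u (S1 S2 : seq 'I_n) :
  uniq (S1 ++ S2) -> rows_sized (S1 ++ S2) rows -> size (rows u) = size S1 ->
  let: (c, t) := extend_row L rows u S2 in
  size c = size (S1 ++ S2) /\
  (t + 2 * 'C(size S1, 2) + 2 * size S1 =
   2 * 'C(size (S1 ++ S2), 2) + 2 * size (S1 ++ S2))%N.
Proof.
rewrite /extend_row; move: (rows u) => c.
elim: S2 S1 c => [|s S2 IH] S1 c U sized sc; first by rewrite cats0 /=; split; lia.
have sz := rows_sized_next U sized.
rewrite /= !bindE /= dot_time size_take sz sc ltnSn minnn.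
set c' := rcons _ _.
have := IH (rcons S1 s) c'; rewrite cat_rcons => /(_ U sized).
rewrite /c' !size_rcons sc => /(_ erefl).
by case: (foldM _ _ _) => c2 t2 /= []; rewrite binS2; split; lia.
Qed.

(** The depth and the extent of a tree survive clearing, hence so does every bound
    on the cost of later queries. *)
Lemma segtree_clear_list (t : segtree R) n (vs : seq 'I_n) :
  let: (t', cost) := foldM (fun t (s : 'I_n) => segtree_update s 0 t) t vs in
  [/\ seg_wf t -> seg_wf t', last_pos t' = last_pos t, depth t' = depth t,
      (cost <= size vs * (2 * depth t + 1))%N
    & seg_wf t -> forall q : 'I_n,
        seg_at t' q = if q \in vs then 0 else seg_at t q].
Proof.
elim: vs t => [|v vs IH] t; first by split.
rewrite [foldM _ _ _]/= bindE.
have := IH (segtree_update v 0 t).1; case: (foldM _ _ _) => t' cost /=.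
rewrite segtree_update_last segtree_update_depth => -[w l d c a].
split=> //; first by move=> wt; apply: w; apply: segtree_update_wf.
  by have := segtree_update_time v 0 t; lia.
move=> wt q; rewrite a ?segtree_update_wf // segtree_clear_at // inE.
by rewrite -val_eqE /=; case: (_ == _); case: (q \in vs).
Qed.

(** The total dimension of the inner products that the steps marked false take. *)
Definition dims (kinds : seq bool) : nat :=
  (\sum_(l < size kinds | ~~ nth false kinds l) l)%N.

Lemma dims_rcons kinds b :
  dims (rcons kinds b) = (dims kinds + if b then 0 else size kinds)%N.
Proof.
rewrite /dims size_rcons big_mkcond big_ord_recr /= nth_rcons ltnn eqxx.
rewrite -big_mkcond /=; congr (_ + _)%N; last by case: b.
by apply: eq_bigl => i; rewrite nth_rcons ltn_ord.
Qed.

Definition star_step n (threshold : R) (rows : 'I_n -> seq R) (cstar cu : seq R)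
    (acc : seq R * seq bool) (sL : 'I_n * R) : timed (seq R * seq bool) :=
  let: (c, kinds) := acc in
  let: (s, Ls) := sL in
  let l := size c in
  let* q := tick (nth 0 cu l / nth 0 cstar l) in
  let* relaxed := tick (q <= threshold) in
  let* y :=
    if relaxed then tick (nth 0 cstar l - nth 0 cu l)
    else
      let* ip := dot c (take l (rows s)) in
      let* x := tick (Ls - ip) in
      tick (x / nth 0 (rows s) l) in
  ret (rcons c y, rcons kinds relaxed).

Lemma stably_compute_diagonalE n tol (S : seq 'I_n) rows cstar
    (trees : 'I_n -> segtree R) u cu :
  let sums := mapM (fun v => star_sum u (trees v)) S in
  let sum_u := star_sum u (trees u) in
  let res := foldM (star_step (tol / (2 + tol)) rows cstar cu) ([::], [::])
               (zip S sums.1) in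
  let ip := dot res.1.1 cu in
  stably_compute_diagonal tol S rows cstar trees u cu =
  ((ip.1 - sum_u.1, res.1.1, res.1.2),
   (sums.2 + sum_u.2 + res.2 + ip.2 + 3)%N).
Proof.
move=> sums sum_u res ip; rewrite /stably_compute_diagonal !bindE /=.
rewrite -/sums -/sum_u.
rewrite (_ : foldM _ _ _ = res) //.
rewrite /ip; case: (res) => [[c kinds] t] /=; rewrite !bindE /=.
by congr (_, _); lia.
Qed.

(** Besides its inner product, if any, a step costs two operations for the test
    and at most two for the new value. *)
Lemma star_fold_cost n threshold (rows : 'I_n -> seq R) cstar cu
    (S1 S2 : seq 'I_n) (Ls : seq R) c kinds :
  uniq (S1 ++ S2) -> rows_sized (S1 ++ S2) rows -> size Ls = size S2 ->
  size c = size S1 -> size kinds = size S1 ->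
  let: ((c', kinds'), t) :=
    foldM (star_step threshold rows cstar cu) (c, kinds) (zip S2 Ls) in
  [/\ size c' = size (S1 ++ S2), size kinds' = size (S1 ++ S2),
      (2 * dims kinds' <= t + 2 * dims kinds)%N
    & (t + 2 * dims kinds <= 2 * dims kinds' + 4 * size S2)%N].
Proof.
elim: S2 S1 Ls c kinds => [|s S2 IH] S1 [|x Ls] c kinds U sized //=.
  by move=> _ sc sk; rewrite cats0; split=> //; lia.
case=> sL sc sk; have sz := rows_sized_next U sized.
rewrite !bindE /=; set rel := (_ <= threshold).
set y := (if rel then _ else _).
have cost_y : y.2 = (if rel then 1 else 2 * size c + 2)%N.
  rewrite /y; case: (rel) => //=; rewrite dot_time size_take sz sc.
  by rewrite ltnSn minnn; lia.
have := IH (rcons S1 s) Ls (rcons c y.1) (rcons kinds rel).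
rewrite cat_rcons !size_rcons sc sk => /(_ U sized sL erefl erefl).
case: (foldM _ _ _) => [[c' kinds'] t] /= [-> ->].
by rewrite dims_rcons cost_y sc sk; case: (rel) => ? ?; split=> //; lia.
Qed.

Lemma star_sum_time n D u (t : segtree R) : seg_wf t -> (last_pos t < n)%N ->
  (depth t <= D)%N -> ((@star_sum R n u t).2 <= 18 * D + 9)%N.
Proof.
move=> w ln dD; rewrite /star_sum !bindE /=.
have := segtree_query_time (a := 0) (b := u) w isT.
have := @segtree_query_time R u.+1 n t w; rewrite ln orbT => /(_ isT).
by lia.
Qed.

Lemma stably_compute_diagonal_cost n D tol (S : seq 'I_n) rows cstar
    (trees : 'I_n -> segtree R) u cu :
  uniq S -> rows_sized S rows -> size cu = size S ->
  (forall v, [/\ seg_wf (trees v), last_pos (trees v) < n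
               & depth (trees v) <= D]%N) ->
  let: ((_, c, kinds), t) :=
    stably_compute_diagonal tol S rows cstar trees u cu in
  [/\ size c = size S, size kinds = size S,
      (2 * (dims kinds + size S) <= t)%N
    & (t <= 2 * (dims kinds + size S) + (size S).+1 * (18 * D + 16))%N].
Proof.
move=> U sized scu wt; rewrite stably_compute_diagonalE.
set sums := mapM _ _.
have size_sums : size sums.1 = size S by rewrite mapM_val size_map.
have sums_time : (sums.2 <= size S * (18 * D + 9))%N.
  rewrite mapM_time -sum1_size big_distrl /= !big_seq; apply: leq_sum => v _.
  by have [*] := wt v; rewrite mul1n star_sum_time.
have := @star_fold_cost n (tol / (2 + tol)) rows cstar cu [::] S sums.1 [::] [::].
move=> /(_ U sized size_sums erefl erefl).
case: (foldM _ _ _) => [[c kinds] t] /= [sc sk].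
have -> : dims [::] = 0%N by rewrite /dims big_ord0.
rewrite dot_time sc scu minnn => lo hi.
have [w l d] := wt u; have := star_sum_time u w l d.
by split=> //; lia.
Qed.

End Shape.

(** * Running time in terms of the counters *)

Section Cost.
Variables (R : realType) (p : problem R).
Local Notation n := (nvert p).
Variables (L : 'I_n -> 'I_n -> R) (D : nat).
Hypothesis D_gt0 : (0 < D)%N.
Implicit Types (st : state R n) (u v w s : 'I_n) (l r h : heap 'I_n).

(** What the running time depends on: the sizes of all data structures, but none
    of the real numbers in them.  A selected vertex s^(j) has j - 1 row entries
    from step (b) and the diagonal entry in addition. *)
Record well_shaped st : Prop := WellShaped {
  shape_perm : perm_eq (chosen st ++ heap_elems (queue st)) (enum 'I_n);
  shape_height : (height (queue st) <= D)%N;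
  shape_rank : forall v, v \in chosen st -> ncomputed st v = index v (chosen st);
  shape_ncomputed : forall v, (ncomputed st v <= size (chosen st))%N;
  shape_row : forall v,
    size (crow st v) = (ncomputed st v + (v \in chosen st))%N;
  shape_tree : forall v, [/\ seg_wf (tree st v), last_pos (tree st v) < n
                           & depth (tree st v) <= D]%N;
  shape_index : all (fun it => 1 <= it_index it <= (size (chosen st)).+1)%N
                    (history st);
  shape_kinds : all (fun it => size (it_relaxed it) == (it_index it).-1)
                    (history st)
}.

Definition offdiag st : nat := (\sum_v 'C(ncomputed st v, 2))%N.

Definition weighted_iterations st : nat :=
  (\sum_(it <- history st) it_index it)%N.

Lemma shape_uniq st : well_shaped st -> uniq (chosen st ++ heap_elems (queue st)).
Proof. by move=> W; rewrite (perm_uniq (shape_perm W)) enum_uniq. Qed.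

Lemma shape_queue st v : well_shaped st ->
  (v \in heap_elems (queue st)) = (v \notin chosen st).
Proof.
move=> W; have := shape_uniq W; rewrite cat_uniq => /and3P[_ /hasPn dis _].
have: v \in chosen st ++ heap_elems (queue st).
  by rewrite (perm_mem (shape_perm W)) mem_enum.
by rewrite mem_cat; case: (boolP (v \in heap_elems _)) => [/dis|_] //=;
  rewrite ?orbF => ->.
Qed.

Lemma shape_rows_sized st : well_shaped st ->
  rows_sized (chosen st) (crow st).
Proof. by move=> W s sS; rewrite (shape_row W) sS (shape_rank W) // addn1. Qed.

Lemma offdiag_refresh st u st1 :
  ncomputed st1 = upd (ncomputed st) u (size (chosen st)) ->
  (offdiag st1 + 'C(ncomputed st u, 2) = offdiag st + 'C(size (chosen st), 2))%N.
Proof.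
move=> E; rewrite /offdiag E (bigD1 u) //= [in RHS](bigD1 u) //= upd_same.
rewrite (eq_bigr (fun v => 'C(ncomputed st v, 2))) ; first by lia.
by move=> v /negbTE vu; rewrite /upd vu.
Qed.

(** The inner products of step (b) have the dimensions b_u, ..., j - 2, whose sum is
    the increase of the binomial coefficient in [offdiag]; those of step (c) are
    counted by [M_diag].  Everything else is the overhead. *)
Lemma refresh_shape st u : well_shaped st -> u \notin chosen st ->
  let: ((st1, d, c), t) := refresh L st u in
  [/\ well_shaped st1,
      [/\ chosen st1 = chosen st, queue st1 = queue st,
          ncomputed st1 = upd (ncomputed st) u (size (chosen st))
        & size c = size (chosen st)],
      exists kinds, history st1 =
        rcons (history st) (IterationRecord (size (chosen st)).+1 u kinds),
      (2 * (offdiag st1 + M_diag st1) <= 2 * (offdiag st + M_diag st) + t)%N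
    & (t + 2 * (offdiag st + M_diag st) <=
       2 * (offdiag st1 + M_diag st1) + 44 * D * (size (chosen st)).+1)%N].
Proof.
move=> W uS; set S := chosen st; set m := size S.
have US : uniq S by have := shape_uniq W; rewrite cat_uniq => /and3P[].
set b := ncomputed st u; have bm : (b <= m)%N := shape_ncomputed W u.
have S_cat : S = take b S ++ drop b S by rewrite cat_take_drop.
have size_take_b : size (take b S) = b by rewrite size_takel.
have sized := shape_rows_sized W.
have := @extend_row_cost R n L (crow st) u (take b S) (drop b S).
rewrite -S_cat size_take_b (shape_row W) (negbTE uS) addn0.
move=> /(_ US sized erefl).
rewrite /refresh !bindE -/S -/b /=.
case: (extend_row _ _ _ _) => cu t1 /= [size_cu cost1].
have [wu lu du] := shape_tree W u.
have := segtree_clear_list (tree st u) (drop b S).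
case: (foldM _ _ _) => tu t2 /= [w2 l2 d2 cost2 _].
have wt v : [/\ seg_wf (upd (tree st) u tu v), last_pos (upd (tree st) u tu v) < n
             & depth (upd (tree st) u tu v) <= D]%N.
  rewrite /upd; case: ifP => _; last exact: shape_tree.
  by rewrite w2 // l2 d2.
have := stably_compute_diagonal_cost (tol p) (cstar st) u US sized size_cu wt.
case: (stably_compute_diagonal _ _ _ _ _ _ _) => [[[d c] kinds] t3] /=.
case=> size_c size_kinds lo3 hi3; rewrite ?bindE /=.
set st1 := State _ _ _ _ _ _ _ _.
have off := @offdiag_refresh st u st1 erefl.
have diag : (M_diag st1 = M_diag st + (dims kinds + m))%N.
  by rewrite /M_diag /= -cats1 big_cat big_seq1 /dims size_kinds.
have cost2' : (t2 <= m * (2 * D + 1))%N.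
  apply: (leq_trans cost2); apply: leq_mul; last by lia.
  by rewrite size_drop leq_subr.
split=> //.
- split=> //=; try solve [by case: W].
  + move=> v vS; rewrite /upd; case: eqP => [E|_]; last exact: (shape_rank W).
    by rewrite E (negbTE uS) in vS.
  + by move=> v; rewrite /upd; case: eqP => // _; apply: (shape_ncomputed W).
  + move=> v; rewrite /upd; case: eqP => [->|_]; last exact: (shape_row W).
    by rewrite (negbTE uS) addn0.
  + by rewrite all_rcons /= ltnSn (shape_index W).
  + by rewrite all_rcons /= size_kinds eqxx (shape_kinds W).
- by exists kinds.
- by move: off diag; rewrite -/b -/S -/m => off diag; rewrite -/m in cost1 lo3; lia.
- move: off diag; rewrite -/b -/S -/m => off diag.
  have mD : (m <= D * m)%N by rewrite leq_pmull.
  by rewrite -/m -/S in cost1 hi3 *; lia.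
Qed.

Lemma clear_trees_spec (trees : 'I_n -> segtree R) u (vs : seq 'I_n) :
  (forall v, [/\ seg_wf (trees v), last_pos (trees v) < n
               & depth (trees v) <= D]%N) ->
  let: (trees', t) := clear_trees trees u vs in
  [/\ forall v, [/\ seg_wf (trees' v), last_pos (trees' v) < n
                  & depth (trees' v) <= D]%N,
      (t <= size vs * (2 * D + 1))%N
    & uniq vs -> forall v, trees' v =
        if v \in vs then (segtree_update u 0 (trees v)).1 else trees v].
Proof.
rewrite /clear_trees; elim: vs trees => [|v vs IH] trees wt; first by split.
have [wv lv dv] := wt v.
rewrite /= !bindE /=; set tr := upd _ _ _.
have /IH : forall w, [/\ seg_wf (tr w), last_pos (tr w) < n & depth (tr w) <= D]%N.
  move=> w; rewrite /tr /upd; case: ifP => _; last exact: wt.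
  by rewrite segtree_update_wf // segtree_update_last segtree_update_depth.
case: (foldM _ _ _) => trees' t /= [wt' cost val].
split=> //; first by have := segtree_update_time u 0 (trees v); lia.
case/andP=> vvs /val E w; rewrite E inE /tr /upd.
by case: (eqVneq w v) => [->|_] //=; rewrite (negbTE vvs).
Qed.

Lemma selected_shape st u l r d c h : well_shaped st -> queue st = Fork u l r ->
  ncomputed st u = size (chosen st) -> size c = size (chosen st) ->
  (height h <= D)%N -> perm_eq (heap_elems h) (heap_elems l ++ heap_elems r) ->
  well_shaped (selected st u d c h).
Proof.
move=> W q bu size_c hh ph.
have uS : u \notin chosen st by rewrite -(shape_queue _ W) q /= mem_head.
have := clear_trees_spec u (chosen st) (shape_tree W).
rewrite /selected; case: (clear_trees _ _ _) => trees t /= [wt _ _].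
split=> //=.
- apply: perm_trans (shape_perm W); rewrite q cat_rcons perm_cat2l /=.
  by rewrite perm_cons.
- move=> v; rewrite mem_rcons inE -cats1 index_cat.
  case: ifP => [vS _|vS]; first exact: (shape_rank W).
  by rewrite orbF => /eqP ->; rewrite /= eqxx addn0.
- by move=> v; rewrite size_rcons; have := shape_ncomputed W v; lia.
- move=> v; rewrite mem_rcons inE /upd; case: eqP => [->|_] /=.
    by rewrite size_rcons (shape_row W) (negbTE uS) addn0 addn1.
  exact: (shape_row W).
- apply: sub_all (shape_index W) => it; rewrite size_rcons; lia.
- exact: (shape_kinds W).
Qed.

Lemma requeued_shape st u l r h : well_shaped st -> queue st = Fork u l r ->
  (height h <= D)%N -> perm_eq (heap_elems h) (heap_elems (queue st)) ->
  well_shaped (requeued st h).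
Proof.
move=> W q hh ph; split=> //=; try solve [by case: W].
by apply: perm_trans (shape_perm W); rewrite perm_cat2l.
Qed.

(** An upper bound for [offdiag] that depends only on the indices of the
    iterations: b_u is always j - 1 for the last iteration that examined u. *)
Definition row_potential st : nat :=
  (\sum_(it <- history st) 'C((it_index it).-1, 2))%N.

(** The increments are written as sums of the old and the new values, so that the
    inequalities can be added along a run. *)
Definition run_cost st t st' : Prop :=
  [/\ (2 * (offdiag st' + M_diag st') <= 2 * (offdiag st + M_diag st) + t)%N,
      (t + 2 * (offdiag st + M_diag st) + 64 * D * weighted_iterations st <=
       2 * (offdiag st' + M_diag st') + 64 * D * weighted_iterations st')%N
    & (offdiag st' + row_potential st <= offdiag st + row_potential st')%N].

Lemma iteration_shape st u l r : well_shaped st -> queue st = Fork u l r ->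
  let: (b, st', t) := iteration L st u l r in
  [/\ well_shaped st', run_cost st t st'
    & b -> chosen st' = chosen st /\ queue st' = queue st].
Proof.
move=> W q.
have uS : u \notin chosen st by rewrite -(shape_queue _ W) q /= mem_head.
have := iterationP L st u l r; have := refresh_shape W uS.
case: (refresh L st u) => [[[st1 d] c] t0] /=.
case=> W1 [eS eq eb size_c] [kinds eh] lo hi.
have q1 : queue st1 = Fork u l r by rewrite eq.
have bu : ncomputed st1 u = size (chosen st1) by rewrite eb upd_same eS.
have size_c1 : size c = size (chosen st1) by rewrite size_c eS.
have := offdiag_refresh eb => off.
have wi : weighted_iterations st1 = (weighted_iterations st + (size (chosen st)).+1)%N.
  by rewrite /weighted_iterations eh -cats1 big_cat big_seq1.
have rp : row_potential st1 = (row_potential st + 'C(size (chosen st), 2))%N.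
  by rewrite /row_potential eh -cats1 big_cat big_seq1.
have rc t : (t0 <= t <= t0 + 20 * D * (size (chosen st)).+1)%N ->
    run_cost st t st1.
  by move=> tt; split; lia.
have mD : (size (chosen st) <= D * size (chosen st))%N by rewrite leq_pmull.
have Dh : (height (Fork u l r) <= D)%N by rewrite -q shape_height.
have gtt := precedes_time (p := p) (rho st1).
have gtv := precedes_val (p := p) (rho st1).
case=> [t _ _ tt|t _ _ tt|t _ tt].
- by split=> //; apply: rc; lia.
- have := clear_trees_spec u (chosen st1) (shape_tree W1).
  case E: (clear_trees _ _ _) => [trees t'] [_ cost _].
  rewrite eS in cost; rewrite E in tt; split=> //; last first.
    apply: (rc t); move: tt; rewrite [(_, _).2]/= => tt.
    by move: (height _) Dh tt => hh Dh tt; lia.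
  apply: (selected_shape d W1 q1 bu size_c1) => //.
    by apply: leq_trans Dh; apply: pop_height gtt gtv _.
  exact: pop_elems gtt gtv _ _ _.
- split=> //; last by apply: (rc t); move: (height _) Dh tt => hh Dh tt; lia.
  apply: (requeued_shape W1 q1) => //.
    by apply: leq_trans Dh; apply: sift_down_height gtt gtv _ _.
  by rewrite q1; apply: sift_down_elems gtt gtv _ _ _ _.
Qed.

Lemma run_cost_trans st1 st2 st3 t t' :
  run_cost st1 t st2 -> run_cost st2 t' st3 -> run_cost st1 (t + t') st3.
Proof. by case=> ? ? ? [? ? ?]; split; lia. Qed.

(** Fewer than n vertices are selected because the queue still contains the vertex
    whose key triggers the termination. *)
Lemma loop_cost st st' t : loop L st st' t -> well_shaped st ->
  [/\ well_shaped st', run_cost st t st' & (steps st' < n)%N].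
Proof.
elim=> {st st' t} [st u l r st' t q|st u l r st' t st'' t' q] E.
  move=> W; have := iteration_shape W q; rewrite E => -[W' rc /(_ isT) [eS eq]].
  split=> //; have := perm_size (shape_perm W').
  by rewrite size_cat size_enum_ord eq q /= /steps; lia.
move=> _ IH W; have := iteration_shape W q; rewrite E => -[W1 rc _].
by have [W2 rc2 lt] := IH W1; split=> //; apply: run_cost_trans rc rc2.
Qed.

End Cost.

(** * Initialization *)

Section Initialization.
Variables (R : realType) (p : problem R).
Local Notation n := (nvert p).
Implicit Types (u v w : 'I_n).

Definition laplacian u v : R := - (rate p u v * weight p 0 v).

Lemma nnz_columns :
  nnz (rate p) = (\sum_v size [seq u <- enum 'I_n | rate p u v != 0%R])%N.
Proof.
rewrite /nnz -sum1_card (eq_bigl (fun e => rate p e.1 e.2 != 0)); last first.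
  by move=> e; rewrite inE.
rewrite -(pair_big_dep xpredT (fun u v => rate p u v != 0) (fun _ _ => 1%N)) /=.
rewrite (exchange_big_dep xpredT) //=; apply: eq_bigr => v _.
by rewrite size_filter -sum1_count big_enum_cond.
Qed.

Lemma nth_enum_map (A : Type) (x0 : A) (f : 'I_n -> A) v :
  nth x0 [seq f w | w <- enum 'I_n] v = f v.
Proof. by rewrite (nth_map v) ?size_enum_ord // nth_ord_enum. Qed.

Lemma initialize_spec D : (n < 2 ^ D)%N ->
  let: (L, st, t) := initialize p in
  [/\ [/\ L = laplacian, chosen st = [::], cstar st = [::],
          ncomputed st = (fun=> 0%N) & crow st = (fun=> [::])],
      [/\ heap_ordered (rho st) (queue st),
          forall v, rho st v = laplacian v v / weight p 0 v
        & forall v w, seg_at (tree st v) w = if w == v then 0 else laplacian w v],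
      well_shaped D st, history st = [::]
    & (2 * nnz (rate p) <= t <= 3 * nnz (rate p) + 13 * n)%N].
Proof.
move=> nD; rewrite /initialize !bindE !mapM_val !mapM_time /=.
pose col v := [seq (u, laplacian u v) | u <- enum 'I_n & rate p u v != 0].
set cols := [seq _ | v <- enum 'I_n].
have nth_cols v : nth [::] cols v = col v.
  by rewrite nth_enum_map mapM_val.
have entryE u v : entry cols u v = laplacian u v.
  rewrite /entry nth_cols /col /unzip1 /unzip2 -!map_comp map_id.
  have [uin|unin] := boolP (u \in [seq u <- enum 'I_n | rate p u v != 0]).
    by rewrite (nth_map u) ?index_mem // nth_index.
  rewrite nth_default; last by rewrite size_map leqNgt index_mem.
  move: unin; rewrite mem_filter mem_enum andbT negbK => /eqP r0.
  by rewrite /laplacian r0 mul0r oppr0.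
pose off v := [seq (val e.1, e.2) | e <- col v & e.1 != v].
have EL : entry cols = laplacian.
  by apply/funext => u; apply/funext => v; apply: entryE.
have size_off v : (size (off v) <= size (col v))%N.
  by rewrite /off size_map size_filter count_size.
have col_n v : (size (col v) <= n)%N.
  by rewrite /col size_map size_filter (leq_trans (count_size _ _)) ?size_enum_ord.
have sorted_off v : sorted ltn (unzip1 (off v)).
  have -> : unzip1 (off v) = [seq val u | u <- enum 'I_n & (u != v) && (rate p u v != 0)].
    rewrite /unzip1 /off -map_comp /col filter_map -map_comp -filter_predI.
    by apply: eq_map.
  apply: (subseq_sorted ltn_trans (s2 := map val (enum 'I_n))).
    exact/map_subseq/filter_subseq.
  by rewrite val_enum_ord iota_ltn_sorted.
have off_n v : (last 0 (unzip1 (off v)) < n)%N.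
  have: all (fun q => q < n)%N (0%N :: unzip1 (off v)).
    rewrite /= (leq_ltn_trans (leq0n v) (ltn_ord v)) /=.
    by apply/allP => _ /mapP[_ /mapP[e _ ->] ->] /=.
  by move/allP; apply; rewrite mem_last.
have tree_spec v := @segtree_init_spec R _ D (off v) (leqnn _)
  (leq_trans (size_off v) (leq_trans (col_n v) (ltnW nD))) (sorted_off v).
have heap_spec := heapify_spec (precedes_time (p := p) _) (precedes_val (p := p) _) _.
have off_at v w : \sum_(e <- off v | e.1 == w) e.2 = if w == v then 0 else laplacian w v.
  rewrite /off big_map big_filter_cond /col big_map big_filter_cond big_enum_cond /=.
  rewrite big_mkcond (bigD1 w) //= eqxx andbT big1 ?addr0.
    case: (w == v); rewrite /= ?andbF // andbT.
    by case: eqP => //= r0; rewrite /laplacian r0 mul0r oppr0.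
  by move=> u uw; rewrite val_eqE (negbTE uw) !andbF.
set rk := (fun v => [seq _ | x <- enum 'I_n]`_v).
have rkE v : rk v = laplacian v v / weight p 0 v by rewrite /rk nth_enum_map EL.
set trees := (fun v => nth SNil _ v).
have treesE v : trees v = (segtree_init (size (off v)) (off v)).1.
  by rewrite /trees nth_enum_map nth_cols.
have [|ph hh oh th] := heap_spec rk n (enum 'I_n); first by rewrite size_enum_ord.
have hD : (up_log 2 (size (enum 'I_n)).+1 <= D)%N.
  by rewrite size_enum_ord up_log_min.
split=> //.
- split=> // v w; rewrite -[nth SNil _ _]/(trees v) treesE; have [_ _ _ ->] := tree_spec v.
  exact: off_at.
- split=> //=; first exact: leq_trans hD.
  move=> v; rewrite treesE; have [[wf _ ->] d _ _] := tree_spec v.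
  by split.
rewrite sum1_size size_enum_ord in th *.
have cols_time : (\sum_(v <- enum 'I_n) (mapM
             (fun u =>
              let* x0 := tick (rate p u v * weight p 0 v)%R
              in let* y := tick (- x0) in ret (u, y))
             [seq u <- enum 'I_n | rate p u v != 0%R]).2 = 2 * nnz (rate p))%N.
  rewrite nnz_columns big_distrr big_enum /=; apply: eq_bigr => v _.
  by rewrite mapM_time -sum1_size big_distrr /=; apply: eq_bigr.
have trees_time : (\sum_(v <- enum 'I_n) (segtree_init
              (size [seq (val e.1, e.2) | e <- nth [::] cols v & e.1 != v])
              [seq (val e.1, e.2) | e <- nth [::] cols v & e.1 != v]).2
   <= nnz (rate p))%N.
  rewrite nnz_columns big_enum; apply: leq_sum => v _; rewrite nth_cols.
  have [_ _ t _] := tree_spec v; apply: (leq_trans t).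
  by rewrite (leq_trans (leq_pred _)) // (leq_trans (size_off v)) // size_map.
rewrite cols_time; move: trees_time th.
set x1 := (\sum_(v <- _) _)%N; set x2 := (heapify _ _ _).2.
by lia.
Qed.

End Initialization.

(** * Cholesky factorization by successive Schur complements *)

Section Cholesky.
Variables (R : realType) (V : finType).
Implicit Types (A : V -> V -> R) (S : seq V) (u v w s : V).

(** The pivot row and column are kept; they become zero. *)
Definition schur A s u v : R := A u v - A u s * A v s / A s s.

Definition schurs A S := foldl schur A S.

(** The row of v in the Cholesky factor that arises from the pivots S. *)
Fixpoint chol A S v : seq R :=
  if S is s :: S' then A v s / Num.sqrt (A s s) :: chol (schur A s) S' v
  else [::].

Fixpoint positive_pivots A S : bool :=
  if S is s :: S' then (0 < A s s) && positive_pivots (schur A s) S' else true.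

Lemma size_chol A S v : size (chol A S v) = size S.
Proof. by elim: S A => //= s S IH A; rewrite IH. Qed.

Lemma chol_cat A S1 S2 v :
  chol A (S1 ++ S2) v = chol A S1 v ++ chol (schurs A S1) S2 v.
Proof. by elim: S1 A => //= s S1 IH A; rewrite IH. Qed.

Lemma chol_rcons A S s v : chol A (rcons S s) v =
  rcons (chol A S v) (schurs A S v s / Num.sqrt (schurs A S s s)).
Proof. by rewrite -!cats1 chol_cat. Qed.

Lemma positive_pivots_cat A S1 S2 : positive_pivots A (S1 ++ S2) =
  positive_pivots A S1 && positive_pivots (schurs A S1) S2.
Proof. by elim: S1 A => //= s S1 IH A; rewrite IH andbA. Qed.

(** Every elimination step subtracts a rank-one matrix, the product of a column of
    the factor and its transpose; the inner product of two rows adds up these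
    subtractions. *)
Lemma dot_chol A S u v : positive_pivots A S ->
  (dot (chol A S u) (chol A S v)).1 = A u v - schurs A S u v.
Proof.
move=> P; rewrite dot_val ?size_chol //.
elim: S A P => [|s S IH] A /=; first by rewrite big_ord0 subrr.
case/andP=> As P; rewrite big_ord_recl /= IH //.
rewrite mulrACA -invfM -expr2 sqr_sqrtr ?ltW // /schur.
by rewrite [schurs _ _ _ _]/= addrA; ring.
Qed.

Lemma div_sqrt (x : R) : 0 < x -> x / Num.sqrt x = Num.sqrt x.
Proof.
move=> x0; rewrite -{1}[x]sqr_sqrtr ?ltW // expr2 mulfK //.
by rewrite gt_eqF // sqrtr_gt0.
Qed.

Lemma schur_sym A s : (forall u v, A u v = A v u) ->
  forall u v, schur A s u v = schur A s v u.
Proof. by move=> symA u v; rewrite /schur symA [A u s * _]mulrC. Qed.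

Lemma schurs_zero_row A S s v : (forall w, A s w = 0) -> schurs A S s v = 0.
Proof.
elim: S A => //= s' S IH A zero; apply: IH => w.
by rewrite /schur !zero !mul0r subrr.
Qed.

Lemma schurs_eliminated A S s v : (forall u v, A u v = A v u) ->
  positive_pivots A S -> s \in S -> schurs A S s v = 0.
Proof.
elim: S A => //= s' S IH A symA /andP[As P]; rewrite inE.
case/orP => [/eqP->|sS]; last exact: IH (schur_sym s' symA) P sS.
apply: schurs_zero_row => w; rewrite /schur.
by rewrite mulrAC divff ?gt_eqF // mul1r symA subrr.
Qed.

Lemma schurs_colsum A S v : (forall v, \sum_w A w v = 0) ->
  \sum_w schurs A S w v = 0.
Proof.
elim: S A => //= s S IH A zero; apply: IH => {}v.
by rewrite sumrB zero sub0r -!mulr_suml zero !mul0r oppr0.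
Qed.

(** The column of u in the Schur complement sums up to zero, and its entries at the
    pivots vanish. *)
Lemma schurs_diag A S u : (forall u v, A u v = A v u) ->
  (forall v, \sum_w A w v = 0) -> positive_pivots A S -> u \notin S ->
  schurs A S u u = - \sum_(w | (w != u) && (w \notin S)) schurs A S w u.
Proof.
move=> symA zero P uS; have := schurs_colsum S u zero.
rewrite (bigD1 u) //= => /(canRL (addrK _)) ->; rewrite sub0r; congr (- _).
rewrite [RHS]big_mkcondr; apply: eq_bigr => w _.
by case: ifPn => // /negPn wS; apply: schurs_eliminated.
Qed.

End Cholesky.

(** * Exactness of the computed quantities *)

Section Exactness.
Variables (R : realType) (n : nat) (L : 'I_n -> 'I_n -> R).
Hypothesis symL : forall u v, L u v = L v u.
Hypothesis colsumL : forall v, \sum_w L w v = 0.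
Implicit Types (u v w s : 'I_n) (S : seq 'I_n) (rows : 'I_n -> seq R).

Definition rows_exact S rows :=
  forall s, s \in S -> rows s = chol L (take (index s S).+1 S) s.

(** The row of a pivot ends with the square root of the pivot. *)
Lemma rows_exact_next S1 S2 s rows :
  uniq (S1 ++ s :: S2) -> positive_pivots L (S1 ++ s :: S2) ->
  rows_exact (S1 ++ s :: S2) rows ->
  rows s = rcons (chol L S1 s) (Num.sqrt (schurs L S1 s s)) /\
  0 < schurs L S1 s s.
Proof.
move=> U; rewrite positive_pivots_cat /= => /and3P[_ pos _] exact.
rewrite exact; last by rewrite mem_cat mem_head orbT.
rewrite index_cat ifN /= ?eqxx ?addn0; last first.
  by move: U; rewrite cat_uniq => /and3P[_ /hasPn/(_ s (mem_head _ _))].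
by rewrite -cat_rcons take_size_cat ?size_rcons // chol_rcons div_sqrt.
Qed.

Lemma extend_row_val rows u S1 S2 :
  uniq (S1 ++ S2) -> positive_pivots L (S1 ++ S2) ->
  rows_exact (S1 ++ S2) rows -> rows u = chol L S1 u ->
  (extend_row L rows u S2).1 = chol L (S1 ++ S2) u.
Proof.
rewrite /extend_row; move: (rows u) => c.
elim: S2 S1 c => [|s S2 IH] S1 c U P exact Ec; first by rewrite cats0.
have [Es pos] := rows_exact_next U P exact.
rewrite /= !bindE /= Es Ec size_chol -[rcons (chol L S1 s) _]cats1 take_size_cat ?size_chol //.
rewrite dot_chol; last by move: P; rewrite positive_pivots_cat => /andP[].
rewrite nth_cat size_chol ltnn subnn /= subKr -cat_rcons.
by apply: IH; rewrite ?cat_rcons // chol_rcons.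
Qed.

Lemma star_sum_val u (t : segtree R) : seg_wf t -> (last_pos t < n)%N ->
  (@star_sum R n u t).1 = \sum_(w < n | w != u) seg_at t w.
Proof.
move=> w l; rewrite /star_sum !bindE /= !(segtree_query_val (n := n)) //.
rewrite [RHS](bigID (fun w : 'I_n => (w < u)%N)) /=; congr (_ + _); apply: eq_bigl => v.
  by rewrite -val_eqE /=; lia.
by rewrite -val_eqE /=; have := ltn_ord v; lia.
Qed.

(** C_* is the sum of the rows of the vertices in P.  The recurrence for an entry of
    a row is linear in the row, so it also holds for this sum; and the row of u
    is the difference between the sum over P and u and the sum over P, which is
    the relaxed formula.  Both branches therefore give the same value, whatever
    the threshold is. *)
Lemma star_fold_val threshold rows cstar u (P : pred 'I_n) S S1 S2 c kinds :
  S = S1 ++ S2 -> uniq S -> positive_pivots L S -> rows_exact S rows ->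
  ~~ P u ->
  (forall i, (i < size S)%N ->
     cstar`_i = \sum_(w | P w || (w == u)) (chol L S w)`_i) ->
  size c = size S1 ->
  (forall i, (i < size S1)%N -> c`_i = \sum_(w | P w) (chol L S w)`_i) ->
  let c' := (foldM (star_step threshold rows cstar (chol L S u)) (c, kinds)
    (zip S2 [seq \sum_(w | P w) L w s | s <- S2])).1.1 in
  size c' = size S /\
  forall i, (i < size S)%N -> c'`_i = \sum_(w | P w) (chol L S w)`_i.
Proof.
move=> + U PS exact nPu Estar.
elim: S2 S1 c kinds => [|s S2 IH] S1 c kinds ES sc Ec /=.
  by rewrite ES cats0 in Ec *; split.
rewrite !bindE /=; set rel := (_ <= threshold).
have [Es pos] : rows s = rcons (chol L S1 s) (Num.sqrt (schurs L S1 s s)) /\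
    0 < schurs L S1 s s by apply: (@rows_exact_next S1 S2); rewrite -ES.
have chol_S w : chol L S w = chol L S1 w ++
    (schurs L S1 w s / Num.sqrt (schurs L S1 s s)) :: behead (chol (schurs L S1) (s :: S2) w).
  by rewrite ES chol_cat.
have next : (size S1 < size S)%N by rewrite ES size_cat /=; lia.
apply: (IH (rcons S1 s)); rewrite ?cat_rcons ?size_rcons ?sc // => i.
rewrite ltnS leq_eqVlt nth_rcons sc => /predU1P[->|iS]; last by rewrite iS Ec.
rewrite ltnn eqxx.
have Estar_u : cstar`_(size S1) - (chol L S u)`_(size S1) =
    \sum_(w | P w) (chol L S w)`_(size S1).
  rewrite Estar // (bigD1 u) /= ?eqxx ?orbT // addrAC subrr add0r; apply: eq_bigl => w.
  by case: (eqVneq w u) => [->|_]; rewrite ?andbF ?(negbTE nPu) ?andbT ?orbF.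
case: (rel) => //=; rewrite ?bindE /= Es -[rcons (chol L S1 s) _]cats1 take_size_cat ?sc ?size_chol //.
rewrite dot_val ?size_chol // sc nth_cat size_chol ltnn subnn /=.
rewrite (eq_bigr (fun i : 'I_(size S1) => \sum_(w | P w) (chol L S1 w)`_i * (chol L S1 s)`_i)); last first.
  move=> j _; rewrite Ec // mulr_suml; apply: eq_bigr => w _.
  by rewrite chol_S nth_cat size_chol ltn_ord.
rewrite exchange_big /= -sumrB mulr_suml; apply: eq_bigr => w _.
rewrite chol_S nth_cat size_chol ltnn subnn /=; congr (_ / _).
have := @dot_chol _ _ L S1 w s; rewrite dot_val ?size_chol // => ->.
  by rewrite subKr.
by move: PS; rewrite ES positive_pivots_cat => /andP[].
Qed.

(** <C_*, C_u> - L_{*u} is the sum over the other remaining vertices w of the negated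
    entries (w, u) of the Schur complement, by [dot_chol]; this sum is the
    diagonal entry by [schurs_diag]. *)
Lemma stably_compute_diagonal_val tol rows cstar (trees : 'I_n -> segtree R) u S :
  uniq S -> positive_pivots L S -> rows_exact S rows -> u \notin S ->
  (forall i, (i < size S)%N ->
     cstar`_i = \sum_(w | w \notin S) (chol L S w)`_i) ->
  (forall v, seg_wf (trees v) /\ (last_pos (trees v) < n)%N) ->
  (forall v w, v \in u :: S ->
     seg_at (trees v) w = if (w == v) || (w \in S) then 0 else L w v) ->
  let: (d, c, _) :=
    (stably_compute_diagonal tol S rows cstar trees u (chol L S u)).1 in
  [/\ d = schurs L S u u, size c = size S
    & forall i, (i < size S)%N ->
        c`_i = \sum_(w | (w != u) && (w \notin S)) (chol L S w)`_i].
Proof.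
move=> US PS exact uS Estar wt at_trees.
pose P w := (w != u) && (w \notin S).
have sumE v : v \in u :: S ->
    (star_sum u (trees v)).1 = \sum_(w | P w) L w v.
  move=> vuS; have [w l] := wt v; rewrite star_sum_val // [RHS]big_mkcondr.
  apply: eq_bigr => x xu; rewrite at_trees //.
  have [E|_] := eqVneq x v; last by rewrite /= -if_neg.
  rewrite E in xu *; move: vuS; rewrite inE (negbTE xu) => /= vS.
  by rewrite vS.
rewrite stably_compute_diagonalE /=.
set sums := mapM _ _.
have -> : sums.1 = [seq \sum_(w | P w) L w s | s <- S].
  by rewrite mapM_val; apply/eq_in_map => s sS; rewrite sumE // inE sS orbT.
have nPu : ~~ P u by rewrite /P eqxx.
have Estar' i : (i < size S)%N ->
    cstar`_i = \sum_(w | P w || (w == u)) (chol L S w)`_i.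
  move=> iS; rewrite Estar //; apply: eq_bigl => w; rewrite /P.
  by case: (eqVneq w u) => [->|_]; rewrite ?orbT ?orbF.
have := @star_fold_val (tol / (2 + tol)) rows cstar u P S [::] S [::] [::].
move=> /(_ erefl US PS exact nPu Estar' erefl).
case=> // size_c Ec.
split=> //; rewrite sumE ?mem_head // dot_val ?size_c ?size_chol //.
rewrite schurs_diag // -/P.
rewrite (eq_bigr (fun i : 'I_(size S) =>
    \sum_(w | P w) (chol L S w)`_i * (chol L S u)`_i)); last first.
  by move=> i _; rewrite Ec // mulr_suml.
rewrite exchange_big /= -sumrB -sumrN; apply: eq_bigr => w _.
have := @dot_chol _ _ L S w u PS; rewrite dot_val ?size_chol // => ->.
by rewrite addrAC subrr add0r.
Qed.

End Exactness.

Section ExactRun.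
Variables (R : realType) (p : problem R).
Local Notation n := (nvert p).
Variables (L : 'I_n -> 'I_n -> R) (D : nat).
Hypothesis symL : forall u v, L u v = L v u.
Hypothesis colsumL : forall v, \sum_w L w v = 0.
Hypothesis D_gt0 : (0 < D)%N.
Implicit Types (st : state R n) (u v w s : 'I_n) (l r h : heap 'I_n).

(** Trees of selected vertices are cleared at every selection, the others only when
    the vertex is examined. *)
Definition cleared st v : seq 'I_n :=
  if v \in chosen st then chosen st else take (ncomputed st v) (chosen st).

Record exact_state st : Prop := ExactState {
  exact_pivots : positive_pivots L (chosen st);
  exact_row : forall v, crow st v =
    chol L (take (ncomputed st v + (v \in chosen st)) (chosen st)) v;
  exact_rho : forall v, v \notin chosen st ->
    rho st v = schurs L (take (ncomputed st v) (chosen st)) v v / weight p 0 v;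
  exact_cstar : forall i, (i < size (chosen st))%N ->
    (cstar st)`_i = \sum_(w | w \notin chosen st) (chol L (chosen st) w)`_i;
  exact_tree : forall v w,
    seg_at (tree st v) w = if (w == v) || (w \in cleared st v) then 0 else L w v
}.

Lemma exact_rows_exact st : well_shaped D st -> exact_state st ->
  rows_exact L (chosen st) (crow st).
Proof.
by move=> W X s sS; rewrite (exact_row X) sS (shape_rank W) // addn1.
Qed.

(** Clearing the new pivots brings the tree of u up to date, and the extended row
    of u is exact, so the stable procedure returns the diagonal entry of the
    current Schur complement. *)
Lemma refresh_exact st u : well_shaped D st -> exact_state st ->
  u \notin chosen st ->
  let: (st1, d, c) := (refresh L st u).1 in
  [/\ exact_state st1, d = schurs L (chosen st) u u,
      rho st1 = upd (rho st) u (d / weight p 0 u),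
      size c = size (chosen st)
    & forall i, (i < size (chosen st))%N -> c`_i =
        \sum_(w | (w != u) && (w \notin chosen st)) (chol L (chosen st) w)`_i].
Proof.
move=> W X uS; set S := chosen st.
have US : uniq S by have := shape_uniq W; rewrite cat_uniq => /and3P[].
set b := ncomputed st u.
have S_cat : S = take b S ++ drop b S by rewrite cat_take_drop.
have rowsX := exact_rows_exact W X.
have := @extend_row_val R n L (crow st) u (take b S) (drop b S).
rewrite -S_cat (exact_row X) (negbTE uS) addn0.
move=> /(_ US (exact_pivots X) rowsX erefl) Ecu.
rewrite /refresh !bindE -/S -/b /=.
move: Ecu; case: (extend_row _ _ _ _) => cu t1 /= ->.
have [wu lu du] := shape_tree W u.
have := segtree_clear_list (tree st u) (drop b S).
case: (foldM _ _ _) => tu t2 /= [w2 l2 d2 cost2 /(_ wu) at2].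
have wt v : seg_wf (upd (tree st) u tu v) /\ (last_pos (upd (tree st) u tu v) < n)%N.
  by rewrite /upd; case: ifP => _; [rewrite w2 // l2|have [] := shape_tree W v].
have at_tu w : seg_at tu w = if (w == u) || (w \in S) then 0 else L w u.
  rewrite at2 (exact_tree X) /cleared (negbTE uS) -/S -/b -{3}(cat_take_drop b S) mem_cat.
  by case: (w == u); case: (w \in take b S); case: (w \in drop b S).
have at_trees v w : v \in u :: S ->
    seg_at (upd (tree st) u tu v) w = if (w == v) || (w \in S) then 0 else L w v.
  rewrite inE /upd; case: eqP => [->|_] //= vS.
  by rewrite (exact_tree X) /cleared vS.
have := stably_compute_diagonal_val symL colsumL (tol p) US (exact_pivots X) rowsX uS
  (exact_cstar X) wt at_trees.
case: (stably_compute_diagonal _ _ _ _ _ _ _) => [[[d c] kinds] t3] /= [Ed sc Ec].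
rewrite ?bindE /=; split=> //.
split=> //=; try exact: exact_pivots X; try exact: exact_cstar X.
- move=> v; rewrite /upd; case: eqP => [->|_]; last exact: (exact_row X).
  by rewrite (negbTE uS) addn0 take_size.
- move=> v vS; rewrite /upd; case: eqP => [->|_]; last exact: (exact_rho X).
  by rewrite take_size Ed.
- move=> v w; rewrite /upd /cleared /=; case: eqP => [->|_].
    by rewrite (negbTE uS) take_size at_tu.
  exact: (exact_tree X).
Qed.

(** The new column of the factor sums up to zero over the vertices that were
    remaining, so its sum without the pivot entry sqrt d is - sqrt d. *)
Lemma selected_exact st u d c h : well_shaped D st -> exact_state st ->
  u \notin chosen st -> ncomputed st u = size (chosen st) ->
  d = schurs L (chosen st) u u -> 0 < d -> size c = size (chosen st) ->
  (forall i, (i < size (chosen st))%N -> c`_i =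
     \sum_(w | (w != u) && (w \notin chosen st)) (chol L (chosen st) w)`_i) ->
  exact_state (selected st u d c h).
Proof.
move=> W X uS bu Ed d_gt0 sc Ec; set S := chosen st.
have US : uniq S by have := shape_uniq W; rewrite cat_uniq => /and3P[].
have := clear_trees_spec D_gt0 u S (shape_tree W); rewrite /selected -/S.
case: (clear_trees _ _ _) => trees t /= [_ _ /(_ US) Etrees].
have take_u k : (k <= size S)%N -> take k (rcons S u) = take k S.
  by move=> kS; rewrite -cats1 takel_cat.
have rowX := exact_row X u; rewrite (negbTE uS) addn0 bu take_size in rowX.
split=> /=.
- by rewrite -cats1 positive_pivots_cat (exact_pivots X) /= -Ed d_gt0.
- move=> v; rewrite mem_rcons inE /upd; case: eqP => [->|_] /=.
    by rewrite rowX bu addn1 take_oversize ?size_rcons // chol_rcons -Ed div_sqrt.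
  rewrite (exact_row X) take_u //; case: (boolP (v \in S)) => [vS|vS].
    by rewrite (shape_rank W) // addn1 index_mem.
  by rewrite addn0 (shape_ncomputed W).
- move=> v; rewrite mem_rcons inE negb_or => /andP[vu vS].
  by rewrite take_u ?(shape_ncomputed W) // (exact_rho X).
- move=> i; rewrite size_rcons ltnS leq_eqVlt nth_rcons sc.
  rewrite (eq_bigl (fun w => (w != u) && (w \notin S))); last first.
    by move=> w; rewrite mem_rcons inE negb_or.
  case/predU1P=> [->|iS]; last first.
    rewrite iS Ec //; apply: eq_bigr => w _.
    by rewrite chol_rcons nth_rcons size_chol iS.
  rewrite ltnn eqxx -div_sqrt // {1}Ed (schurs_diag symL colsumL (exact_pivots X) uS).
  rewrite mulNr opprK mulr_suml; apply: eq_bigr => w _.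
  by rewrite chol_rcons nth_rcons size_chol ltnn eqxx -Ed.
- move=> v w; rewrite Etrees /cleared /= mem_rcons inE.
  have [w_tree _ _] := shape_tree W v.
  case: (boolP (v \in S)) => vS; last first.
    case: (eqVneq v u) => [E|_] /=; rewrite (exact_tree X) /cleared -/S (negbTE vS).
      rewrite E bu take_size mem_rcons inE.
      by case: (w == u).
    by rewrite take_u ?(shape_ncomputed W).
  rewrite orbT segtree_clear_at // (exact_tree X) /cleared -/S vS mem_rcons inE.
  rewrite (_ : (nat_of_ord w == nat_of_ord u) = (w == u)) //.
  by case: (w == u); case: (w == v).
Qed.

End ExactRun.

(** * Termination *)

Section Termination.
Variables (R : realType) (p : problem R).
Local Notation n := (nvert p).
Variables (L : 'I_n -> 'I_n -> R) (D : nat).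
Hypothesis symL : forall u v, L u v = L v u.
Hypothesis colsumL : forall v, \sum_w L w v = 0.
Hypothesis D_gt0 : (0 < D)%N.
Hypothesis tmax_gt0 : 0 < tmax p.
Hypothesis weight_gt0 : forall v, 0 < weight p 0 v.
Implicit Types (st : state R n) (u v w s : 'I_n) (l r h : heap 'I_n).

Lemma eq_root_below (rk rk' : 'I_n -> R) b h :
  {in heap_elems h, rk =1 rk'} -> root_below rk b h = root_below rk' b h.
Proof. by case: h => //= y l r E; rewrite /root_below /= E ?mem_head. Qed.

Lemma eq_heap_ordered (rk rk' : 'I_n -> R) h :
  {in heap_elems h, rk =1 rk'} -> heap_ordered rk h = heap_ordered rk' h.
Proof.
elim: h => //= x l IHl r IHr E.
have El : {in heap_elems l, rk =1 rk'}.
  by move=> y yl; apply: E; rewrite inE mem_cat yl orbT.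
have Er : {in heap_elems r, rk =1 rk'}.
  by move=> y yr; apply: E; rewrite inE mem_cat yr !orbT.
rewrite (IHl El) (IHr Er) (eq_root_below _ El) (eq_root_below _ Er).
by rewrite E ?mem_head.
Qed.

(** Selected vertices are stale as well; this does no harm, since only the bound n
    and the decrease under an examination matter. *)
Definition stale st : {set 'I_n} :=
  [set v | ncomputed st v < size (chosen st)]%N.

Definition remaining_work st : nat :=
  (size (heap_elems (queue st)) * n.+1 + #|stale st|)%N.

(** A selection shortens the queue.  Otherwise the root u was stale and becomes
    fresh: for a fresh root the recomputed key equals the stored one and passes
    the test of step (e) by heap order.  The weight n + 1 of the queue length
    outweighs the selected vertex making all others stale.  The queue cannot
    run empty: if u were the only remaining vertex, then d, as the empty sum in
    [schurs_diag], would be zero and u would not be selected. *)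
Lemma loop_exists m st : well_shaped D st -> exact_state L st ->
  heap_ordered (rho st) (queue st) -> queue st <> Empty ->
  (remaining_work st < m)%N -> exists st' t, loop L st st' t.
Proof.
elim: m st => [//|m IH] st W X; case q: (queue st) => [//|u l r] ord _ work.
have uS : u \notin chosen st by rewrite -(shape_queue _ W) q /= mem_head.
have := shape_uniq W; rewrite q cat_uniq => /and3P[US _ /= /andP[ulr _]].
have := iterationP L st u l r; have := refresh_shape L D_gt0 W uS.
have := refresh_exact symL colsumL W X uS.
case: (refresh L st u) => [[[st1 d] c] t0] /=.
move=> [X1 Ed Erho _ Ec] [W1 [eS eq eb size_c] _ _ _].
have q1 : queue st1 = Fork u l r by rewrite eq.
have gtt := precedes_time (p := p) (rho st1).
have gtv := precedes_val (p := p) (rho st1).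
have [ol or] : heap_ordered (rho st1) l /\ heap_ordered (rho st1) r.
  have Erk h : {subset heap_elems h <= heap_elems l ++ heap_elems r} ->
      {in heap_elems h, rho st =1 rho st1}.
    move=> sub v /sub vlr; rewrite Erho /upd.
    by case: eqP vlr ulr => // -> ->.
  case/and4P: ord => _ _ ol or; split.
    by rewrite -(eq_heap_ordered (Erk l _)) // => v vl; rewrite mem_cat vl.
  by rewrite -(eq_heap_ordered (Erk r _)) // => v vr; rewrite mem_cat vr orbT.
have bu : ncomputed st1 u = size (chosen st1) by rewrite eb upd_same eS.
have rho_u : rho st1 u = d / weight p 0 u by rewrite Erho upd_same.
case E: _ / => [t _ _ _|t /andP[bl br] large _|t root_not_max _].
- by exists st1, t; apply: loop_stop q E.
- have d_gt0 : 0 < d.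
    rewrite -(pmulr_lgt0 _ (x := (weight p 0 u)^-1)) ?invr_gt0 // -rho_u.
    by apply: lt_le_trans large; rewrite divr_gt0.
  set st2 := selected _ _ _ _ _ in E.
  have W2 : well_shaped D st2.
    apply: (selected_shape D_gt0 d W1 q1 bu); rewrite ?eS //.
      by apply: leq_trans (pop_height gtt gtv _) _; rewrite -q1 shape_height.
    exact: pop_elems gtt gtv _ _ _.
  have X2 : exact_state L st2.
    apply: (selected_exact symL colsumL D_gt0 _ W1 X1 _ bu); rewrite ?eS //.
  have ord2 : heap_ordered (rho st2) (queue st2).
    by apply: pop_ordered gtt gtv _ _; rewrite /= bl br ol or.
  have sz : size (heap_elems (queue st)) = (size (heap_elems (queue st2))).+1.
    rewrite q /= (perm_size (pop_elems gtt gtv u l r)) //.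
  have ne : queue st2 <> Empty.
    move=> E0; have lr0 : heap_elems l ++ heap_elems r = [::].
      by apply: size0nil; move: sz; rewrite E0 q => -[].
    move: d_gt0; rewrite Ed schurs_diag ?(exact_pivots X) // big_pred0 ?oppr0 ?ltxx //.
    move=> w; rewrite -(shape_queue _ W) q /= lr0 inE; exact: andNb.
  have [|st' [t' run]] := IH st2 W2 X2 ord2 ne.
    rewrite ltnS in work; apply: leq_trans work; rewrite /remaining_work sz mulSnr -addnA ltn_add2l.
    by rewrite ltn_addr // ltnS -[X in (_ <= X)%N]card_ord max_card.
  by exists st', (t + t')%N; apply: loop_next q E run.
- set st2 := requeued _ _ in E.
  have W2 : well_shaped D st2.
    apply: (requeued_shape W1 q1).
      by apply: leq_trans (sift_down_height gtt gtv _ _) _; rewrite -q1 shape_height.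
    by rewrite q1; apply: sift_down_elems gtt gtv _ _ _ _.
  have X2 : exact_state L st2 by case: X1.
  have ord2 : heap_ordered (rho st2) (queue st2).
    by have [] := sift_down_ordered gtt gtv u u ol or.
  have perm2 := sift_down_elems gtt gtv u u l r.
  have ne : queue st2 <> Empty.
    by move=> E0; move: (perm_size perm2); rewrite -[(sift_down _ _ _).1]/(queue st2) E0.
  have [|st' [t' run]] := IH st2 W2 X2 ord2 ne; last first.
    by exists st', (t + t')%N; apply: loop_next q E run.
  have lt : (ncomputed st u < size (chosen st))%N.
    rewrite ltn_neqAle (shape_ncomputed W) andbT; apply: contra root_not_max => /eqP full.
    have -> : rho st1 = rho st.
      apply/funext => v; rewrite Erho /upd; case: eqP => // ->.
      by rewrite (exact_rho X uS) full take_size Ed.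
    by case/and4P: ord => -> ->.
  have lt_stale : (#|stale st2| < #|stale st|)%N.
    apply/proper_card/properP; split.
      apply/subsetP => v; rewrite !inE /= eS eb /upd.
      by case: eqP => //; rewrite ltnn.
    by exists u; rewrite !inE //= bu ltnn.
  rewrite ltnS in work; apply: leq_trans work; rewrite /remaining_work q.
  by rewrite -[(sift_down _ _ _).1]/(queue st2) in perm2; rewrite (perm_size perm2) ltn_add2l.
Qed.

End Termination.

(** * Executions *)

Section Executions.
Variables (R : realType) (p : problem R).
Local Notation n := (nvert p).

Definition log_bound : nat := (trunc_log 2 n).+1.

Lemma log_bound_spec : (n < 2 ^ log_bound)%N.
Proof. exact: trunc_log_ltn. Qed.

Lemma log_bound_gt0 : (0 < log_bound)%N.
Proof. by []. Qed.

Hypothesis validp : valid p.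

Lemma laplacian_sym u v : laplacian (p := p) u v = laplacian v u.
Proof. by have [_ [_ _ _ rev] _ _ _] := validp; rewrite /laplacian rev. Qed.

Lemma laplacian_colsum v : \sum_u laplacian (p := p) u v = 0.
Proof.
have [_ [_ diag _ _] _ _ _] := validp.
rewrite sumrN -mulr_suml (bigD1 v) //= diag addrC subrr mul0r oppr0 //.
Qed.

Lemma termination : exists (st : state R n) t, executes st t.
Proof.
have [n_gt0 [_ _ pi_gt0 _] tmax_gt0 _ _] := validp.
have := initialize_spec log_bound_spec.
case Einit: (initialize p) => [[L st] t] [[EL ES Ec Eb Er] [ord rk at_tree] W _ _].
have X : exact_state L st.
  split; rewrite ?ES //.
  - by move=> v; rewrite Er.
  - by move=> v _; rewrite rk EL.
  - by move=> v w; rewrite at_tree /cleared ES Eb EL orbF.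
have ne : queue st <> Empty.
  move=> Eq; have := perm_size (shape_perm W).
  by rewrite ES Eq size_enum_ord /= => n0; rewrite -n0 in n_gt0.
have symL u v : L u v = L v u by rewrite EL laplacian_sym.
have colL v : \sum_w L w v = 0 by rewrite EL laplacian_colsum.
have [st' [t' run]] :=
  loop_exists symL colL log_bound_gt0 tmax_gt0 pi_gt0 W X ord ne (ltnSn _).
by exists st', (t + t')%N, L, st, t, t'.
Qed.

Lemma execution_cost (st : state R n) t : executes st t ->
  [/\ well_shaped log_bound st, (steps st < n)%N,
      (offdiag st <= row_potential st)%N,
      (2 * (offdiag st + M_diag st + nnz (rate p)) <= t)%N
    & (t <= 2 * (offdiag st + M_diag st) + 3 * nnz (rate p) + 13 * n
            + 64 * log_bound * weighted_iterations st)%N].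
Proof.
case=> L [st0 [t0 [t1 [init run ->]]]].
have := initialize_spec log_bound_spec; rewrite init.
case=> [[_ _ _ b0 _] _ W hist0 /andP[lo hi]].
have off0 : offdiag st0 = 0%N by rewrite /offdiag b0 big1.
have [W' [lo' hi' pot] lt] := loop_cost log_bound_gt0 run W.
have diag0 : M_diag st0 = 0%N by rewrite /M_diag hist0 big_nil.
have wi0 : weighted_iterations st0 = 0%N.
  by rewrite /weighted_iterations hist0 big_nil.
have pot0 : row_potential st0 = 0%N by rewrite /row_potential hist0 big_nil.
rewrite off0 diag0 wi0 pot0 in lo' hi' pot.
by split=> //; lia.
Qed.

Lemma M_offdiagE (st : state R n) : M_offdiag st = (offdiag st)%:R.
Proof.
rewrite /M_offdiag /offdiag.
have -> : (\sum_(v < n) ncomputed st v * (ncomputed st v).-1 =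
           2 * \sum_v 'C(ncomputed st v, 2))%N.
  rewrite big_distrr; apply: eq_bigr => v _ /=.
  by rewrite bin2 mul2n; have := odd_double_half (ncomputed st v * (ncomputed st v).-1);
    case: (ncomputed st v) => //= m; rewrite oddM /= andNb.
by rewrite natrM mulrAC divff ?mul1r // pnatr_eq0.
Qed.

(** * Counters as sums over the iterations *)

Lemma history_sum D (st : state R n) (F : nat -> nat) : well_shaped D st ->
  (\sum_(it <- history st) F (it_index it) =
   \sum_(1 <= j < (steps st).+2) num_iterations st j * F j)%N.
Proof.
move=> W; have := shape_index W; rewrite /num_iterations /steps.
elim: (history st) => [|it h IH] /=; first by rewrite big_nil big1.
case/andP=> /andP[j1 jk] /IH {}IH; rewrite big_cons IH.
under [RHS]eq_bigr do rewrite mulnDl.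
rewrite big_split /=; congr (_ + _)%N.
rewrite (big_cat_nat (n := it_index it)) //=; last by lia.
rewrite [X in _ = (_ + X)%N]big_ltn ?ltnS // eqxx mul1n.
rewrite [X in _ = (X + _)%N]big_nat big1 ?add0n; last first.
  by move=> j /andP[_ lt]; rewrite gtn_eqF.
rewrite [X in _ = (_ + X)%N]big_nat big1 ?addn0 // => j /andP[lt _].
by rewrite ltn_eqF.
Qed.

Lemma M_diag_bounds (st : state R n) :
  (\sum_(it <- history st) (it_index it).-1 <= M_diag st
   <= \sum_(it <- history st) 'C(it_index it, 2))%N.
Proof.
rewrite /M_diag; apply/andP; split; apply: leq_sum => it _.
  exact: leq_addl.
case: (it_index it) => [|m] /=; first by rewrite big_ord0.
rewrite binS2 leq_add2r -bin2_sum big_mkord big_mkcond /=.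
by apply: leq_sum => l _; case: ifP.
Qed.

Lemma M_diag_relax_best D (st : state R n) : well_shaped D st -> relax_best st ->
  (M_diag st = \sum_(it <- history st) (it_index it).-1)%N.
Proof.
move=> W; rewrite /relax_best /M_diag; have := shape_kinds W.
elim: (history st) => [|it h IH] /=; first by rewrite !big_nil.
case/andP=> /eqP sz /IH {}IH /andP[all_id /IH {}IH]; rewrite !big_cons IH.
congr (_ + _)%N; rewrite big_pred0 // => l.
have -> // : nth false (it_relaxed it) l.
  by apply: (allP all_id); rewrite mem_nth // sz.
Qed.

Lemma M_diag_relax_worst (st : state R n) : relax_worst st ->
  (M_diag st = \sum_(it <- history st) 'C(it_index it, 2))%N.
Proof.
rewrite /relax_worst /M_diag.
elim: (history st) => [|it h IH] /=; first by rewrite !big_nil.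
case/andP=> all_neg /IH {}IH; rewrite !big_cons IH; congr (_ + _)%N.
case: (it_index it) => [|m] /=; first by rewrite big_ord0.
rewrite binS2 -bin2_sum big_mkord; congr (_ + _)%N; apply: eq_bigl => l.
have [lt|ge] := ltnP l (size (it_relaxed it)); last by rewrite nth_default.
exact: (allP all_neg _ (mem_nth _ lt)).
Qed.

(** The (i + 1)st selected vertex has b_v = i. *)
Lemma offdiag_ge_chosen D (st : state R n) : well_shaped D st ->
  (\sum_(i < steps st) 'C(i, 2) <= offdiag st)%N.
Proof.
move=> W; have : uniq (chosen st).
  by have := shape_uniq W; rewrite cat_uniq => /and3P[].
move=> U; rewrite /offdiag (bigID (mem (chosen st))) /=.
apply: leq_trans (leq_addr _ _).
rewrite (eq_bigr (fun v => 'C(index v (chosen st), 2))); last first.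
  by move=> v vS; rewrite (shape_rank W).
rewrite -big_uniq //= /steps.
case E: (chosen st) U => [|x S] U; first by rewrite big_ord0 big_nil.
rewrite (big_nth x) big_mkord; apply: eq_leq; apply: eq_bigr => i _.
by rewrite index_uniq.
Qed.

Lemma offdiag_le D (st : state R n) : well_shaped D st ->
  (offdiag st <= n * 'C(steps st, 2))%N.
Proof.
move=> W; rewrite /offdiag -[n in (n * _)%N]card_ord -sum_nat_const.
by apply: leq_sum => v _; apply: leq_bin2l; apply: shape_ncomputed W _.
Qed.

End Executions.

(** * Polynomial bounds on the counters *)

Section Polynomials.

Lemma leq_powers k : (k <= k ^ 2 <= k ^ 3)%N.
Proof. by case: k => // k; rewrite !expnS expn0 muln1; nia. Qed.

Lemma bin2_double m : (2 * 'C(m.+1, 2) = m * m + m)%N.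
Proof. by elim: m => // m IH; rewrite binS2; lia. Qed.

Lemma sum_succ k : (2 * \sum_(1 <= j < k.+2) j = k * k + 3 * k + 2)%N.
Proof. by elim: k => [|k IH]; [rewrite big_nat1|rewrite big_nat_recr //=; lia]. Qed.

Lemma sum_pred k : (2 * \sum_(1 <= j < k.+2) j.-1 = k * k + k)%N.
Proof. by elim: k => [|k IH]; [rewrite big_nat1|rewrite big_nat_recr //=; lia]. Qed.

Lemma sum_bin2 k :
  (6 * \sum_(1 <= j < k.+2) 'C(j, 2) = k ^ 3 + 3 * k ^ 2 + 2 * k)%N.
Proof.
elim: k => [|k IH]; first by rewrite big_nat1.
by rewrite big_nat_recr //=; have := bin2_double k.+1; lia.
Qed.

Lemma sum_bin2_pred k : (6 * \sum_(1 <= j < k.+2) 'C(j.-1, 2) + k = k ^ 3)%N.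
Proof.
elim: k => [|k IH]; first by rewrite big_nat1.
by rewrite big_nat_recr //=; have := bin2_double k; lia.
Qed.

Lemma sum_bin2_ord k : (6 * \sum_(i < k) 'C(i, 2) + 3 * k ^ 2 = k ^ 3 + 2 * k)%N.
Proof.
rewrite -(big_mkord xpredT (fun i => 'C(i, 2))).
elim: k => [|k IH]; first by rewrite big_geq.
by rewrite big_nat_recr //=; have := bin2_double k; have := binS2 k; lia.
Qed.

(** The closed forms of the next two sums have terms of both signs; the negative ones
    are moved to the other side because n - j is truncated. *)
Lemma worst_sum_pred n k : (k < n)%N ->
  (6 * \sum_(2 <= j < k.+2) (n - j + 1) * j.-1 + k * k.+1 * (2 * k + 1)
   = 3 * n * (k * k.+1))%N.
Proof.
elim: k => [|k IH] kn; first by rewrite big_geq //; lia.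
have /IH : (k < n)%N by lia.
rewrite [X in _ -> (6 * X + _ = _)%N]big_nat_recr //=.
have [r ->] : exists r, n = (r + k + 2)%N by exists (n - k - 2)%N; lia.
have -> : (r + k + 2 - k.+2 + 1 = r.+1)%N by lia.
lia.
Qed.

Lemma worst_sum_bin2 n k : (k < n)%N ->
  (24 * \sum_(2 <= j < k.+2) (n - j + 1) * 'C(j, 2)
   + k * k.+1 * k.+2 * (3 * k + 1) = 4 * n * (k * k.+1 * k.+2))%N.
Proof.
elim: k => [|k IH] kn; first by rewrite big_geq //; lia.
have /IH : (k < n)%N by lia.
rewrite [X in _ -> (24 * X + _ = _)%N]big_nat_recr //=.
have [r ->] : exists r, n = (r + k + 2)%N by exists (n - k - 2)%N; lia.
have -> : (r + k + 2 - k.+2 + 1 = r.+1)%N by lia.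
have : (2 * (r.+1 * 'C(k.+2, 2)) = r.+1 * (k.+1 * k.+1 + k.+1))%N.
  by rewrite mulnCA bin2_double.
by lia.
Qed.

End Polynomials.

(** * Asymptotics *)

Section Asymptotics.
Variable R : realType.

(** The part of T up to (a + b) f is charged to f and the excess to g.  The factor
    exceeds b so that the first part is at least a f, even if b < a. *)
Lemma Theta_plus_O_intro (I : Type) (P : I -> Prop) (T f g : I -> R) :
  (forall i, P i -> 0 <= f i /\ 0 <= g i) ->
  (exists a b c : R, [/\ 0 < a, 0 < b, 0 < c &
     forall i, P i -> a * f i <= T i <= b * f i + c * g i]) ->
  Theta_plus_O P T f g.
Proof.
move=> fg_ge0 [a [b [c [a0 b0 c0 bounds]]]].
exists (fun i => Num.min (T i) ((a + b) * f i)).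
exists (fun i => T i - Num.min (T i) ((a + b) * f i)); split.
- exists a, (a + b); split; rewrite ?addr_gt0 // => i Pi.
  have [f0 g0] := fg_ge0 i Pi; have /andP[lo hi] := bounds i Pi.
  rewrite le_min lo ge_min lexx orbT andbT /=.
  by rewrite ler_wpM2r // lerDl ltW.
- exists c => // i Pi; have [f0 g0] := fg_ge0 i Pi.
  have /andP[lo hi] := bounds i Pi; have af0 := mulr_ge0 (ltW a0) f0.
  have cg0 := mulr_ge0 (ltW c0) g0.
  by case: (leP (T i) ((a + b) * f i)) => H; [rewrite subrr lexx|rewrite mulrDl in H *; lra].
- by move=> i _; rewrite addrC subrK.
Qed.

Variable c0 : R.
Hypothesis c0_gt0 : 0 < c0.
Implicit Types e : execution R.

Definition counters e : R :=
  M_offdiag (final e) + (M_diag (final e))%:R + nnz_of e.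

Definition log_work e : R :=
  (weighted_iterations (final e))%:R * ln (n_of e).

(** A rate constant matrix of order one is zero, so nnz(K) >= c0 n excludes it.  This
    matters because ln 1 = 0 could not absorb any constant. *)
Lemma admissible_nvert e : admissible c0 e -> (1 < nvert (input e))%N.
Proof.
case=> [[n_gt0 [_ diag _ _] _ _ _] _ dense].
rewrite ltnNge; apply/negP => n_le1.
have u_eq_v (u v : 'I_(nvert (input e))) : u = v.
  by apply: val_inj => /=; have := ltn_ord u; have := ltn_ord v; lia.
have K0 u v : rate (input e) u v = 0.
  by rewrite (u_eq_v u v) diag big_pred0 ?oppr0 // => w; rewrite (u_eq_v w v) eqxx.
suff nnz0 : nnz (rate (input e)) = 0%N.
  by move: dense; rewrite nnz0 leNgt mulr_gt0 ?ltr0n.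
by apply/eqP; rewrite cards_eq0; apply/eqP/setP => x; rewrite !inE K0 eqxx.
Qed.

Lemma log_bound_ln n : (1 < n)%N ->
  (trunc_log 2 n).+1%:R * ln (2 : R) <= 2 * ln (n%:R : R).
Proof.
move=> n_gt1; have n_gt0 : (0 < n)%N by lia.
have ln2 : ln (2 : R) <= ln (n%:R : R).
  by rewrite ler_ln ?posrE ?ltr0n // ler_nat.
have : ln (((2 : R) ^+ trunc_log 2 n)) <= ln (n%:R : R).
  rewrite ler_ln ?posrE ?ltr0n ?exprn_gt0 // -natrX ler_nat.
  by apply: trunc_logP.
rewrite lnXn // mulrS mulrDl mul1r mulr_natl => H; lra.
Qed.

Lemma admissible_bounds : exists b c : R, [/\ 0 < b, 0 < c &
  forall e, admissible c0 e ->
    2 * counters e <= running_time e <= b * counters e + c * log_work e].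
Proof.
have ln2_gt0 : 0 < ln (2 : R) by rewrite ln_gt0 // ltr1n.
(* 13 n is at most (13 / c0) nnz(K), and depths are at most (2 / ln 2) ln n. *)
exists (3 + 13 / c0), (64 * (2 / ln 2)); split.
- by rewrite addr_gt0 // divr_gt0.
- by rewrite !mulr_gt0 // invr_gt0.
move=> e adm; have n_gt1 := admissible_nvert adm.
have [_ exec dense] := adm.
have [_ _ _ lo hi] := execution_cost exec.
rewrite /counters /log_work /running_time /n_of /nnz_of M_offdiagE.
set N := nnz _ in lo hi dense *.
set n := nvert _ in n_gt1 hi dense *.
set O := offdiag _ in lo hi *; set M := M_diag _ in lo hi *.
set W := weighted_iterations _ in hi *.
set t := time e in lo hi *.
have loR : (2 * (O + M + N))%N%:R <= t%:R :> R by rewrite ler_nat.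
have hiR : t%:R <= (2 * (O + M) + 3 * N + 13 * n + 64 * log_bound (input e) * W)%N%:R :> R.
  by rewrite ler_nat.
rewrite !(natrD, natrM) in loR hiR.
apply/andP; split; first by lra.
have nN : n%:R <= N%:R / c0 by rewrite ler_pdivlMr // mulrC.
have logD : (log_bound (input e))%:R <= 2 / ln 2 * ln (n%:R : R).
  by rewrite mulrAC ler_pdivlMr // log_bound_ln.
have logDW : (log_bound (input e))%:R * W%:R <= 2 / ln 2 * ln (n%:R : R) * W%:R.
  by rewrite ler_wpM2r.
have [O0 M0] : 0 <= O%:R :> R /\ 0 <= M%:R :> R by [].
have q0 : 0 <= 13 / c0 by rewrite divr_ge0 ?ltW.
have OM : 0 <= 13 / c0 * (O%:R + M%:R) by rewrite mulr_ge0 // addr_ge0.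
have -> : (3 + 13 / c0) * (O%:R + M%:R + N%:R) + 64 * (2 / ln 2) * (W%:R * ln n%:R)
  = 3 * (O%:R + M%:R + N%:R) + 13 / c0 * (O%:R + M%:R) + 13 * (N%:R / c0)
    + 64 * (2 / ln 2 * ln n%:R * W%:R).
  by ring.
lra.
Qed.

Lemma Theta_plus_O_admissible (P : execution R -> Prop) (f g : execution R -> R) :
  (forall e, P e -> admissible c0 e) ->
  (forall e, P e -> 0 <= f e /\ 0 <= g e) ->
  (exists a b d : R, [/\ 0 < a, 0 < b, 0 < d & forall e, P e ->
     [/\ a * f e <= counters e, counters e <= b * f e
       & log_work e <= d * (f e + g e)]]) ->
  Theta_plus_O P (@running_time R) f g.
Proof.
move=> Padm fg [a [b [d [a0 b0 d0 bounds]]]].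
have [b1 [c1 [b10 c10 adm]]] := admissible_bounds.
apply: Theta_plus_O_intro => //.
exists (2 * a), (b1 * b + c1 * d), (c1 * d); split.
- exact: mulr_gt0.
- by rewrite addr_gt0 // mulr_gt0.
- exact: mulr_gt0.
move=> e Pe; have [lo hi lw] := bounds e Pe.
have /andP[t_lo t_hi] := adm e (Padm e Pe).
apply/andP; split; first by lra.
have h1 : b1 * counters e <= b1 * (b * f e) by rewrite ler_pM2l.
have h2 : c1 * log_work e <= c1 * (d * (f e + g e)) by rewrite ler_pM2l.
have -> : (b1 * b + c1 * d) * f e + c1 * d * g e =
  b1 * (b * f e) + c1 * (d * (f e + g e)) by ring.
lra.
Qed.

End Asymptotics.

(** * The best and the worst cases of the heuristics *)

Section Cases.
Variables (R : realType) (p : problem R).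
Local Notation n := (nvert p).
Implicit Types (st : state R n).

Lemma history_sum_best D st (F : nat -> nat) : well_shaped D st ->
  lazy_best st ->
  (\sum_(it <- history st) F (it_index it) = \sum_(1 <= j < (steps st).+2) F j)%N.
Proof.
move=> W best; rewrite (history_sum _ W); apply: eq_big_nat => j jk.
by rewrite best ?mul1n // -ltnS.
Qed.

Lemma history_sum_worst D st (F : nat -> nat) : well_shaped D st ->
  lazy_worst st ->
  (\sum_(it <- history st) F (it_index it) =
   F 1 + \sum_(2 <= j < (steps st).+2) (n - j + 1) * F j)%N.
Proof.
move=> W [first next _]; rewrite (history_sum _ W) big_ltn // first mul1n.
by congr (_ + _)%N; apply: eq_big_nat => j jk; rewrite next // -ltnS.
Qed.

Lemma worst_sum_le k (F : nat -> nat) : (k < n)%N ->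
  (\sum_(2 <= j < k.+2) (n - j + 1) * F j <= n * \sum_(2 <= j < k.+2) F j)%N.
Proof.
move=> kn; rewrite big_distrr !big_nat; apply: leq_sum => j /andP[j2 _] /=.
by rewrite leq_mul2r; lia.
Qed.

Lemma lazy_best_counters D st : well_shaped D st -> lazy_best st ->
  (offdiag st <= row_potential st)%N ->
  [/\ (steps st ^ 3 <= 6 * (offdiag st + M_diag st))%N,
      (offdiag st + M_diag st <= steps st ^ 3)%N
    & (weighted_iterations st <= 2 * steps st ^ 2 + 1)%N].
Proof.
move=> W best; have := offdiag_ge_chosen W; have := M_diag_bounds st.
rewrite /row_potential /weighted_iterations.
rewrite (history_sum_best predn W best) (history_sum_best id W best).
rewrite (history_sum_best (fun j => 'C(j, 2)) W best).
rewrite (history_sum_best (fun j => 'C(j.-1, 2)) W best) => /andP[lo hi] lo' hi'.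
set k := steps st in lo lo' hi hi' *.
have /andP[k12 k23] := leq_powers k.
have := sum_bin2_pred k; have := sum_bin2 k; have := sum_pred k.
by have := sum_succ k; have := sum_bin2_ord k; split; lia.
Qed.

Lemma lazy_worst_weight D st : well_shaped D st -> lazy_worst st ->
  (steps st < n)%N ->
  (weighted_iterations st <= 2 * (steps st ^ 2 * n) + 1)%N.
Proof.
move=> W worst kn; rewrite /weighted_iterations (history_sum_worst id W worst).
move: kn; set k := steps st => kn.
have := sum_succ k; rewrite big_ltn // => sum_k.
have k12 : (n * k <= n * k ^ 2)%N.
  by have /andP[k12 _] := leq_powers k; rewrite leq_mul2l k12 orbT.
have : (n * (2 * \sum_(2 <= j < k.+2) j) = n * (k * k + 3 * k))%N by congr muln; lia.
have := worst_sum_le id kn; lia.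
Qed.

Lemma offdiag_le_square D st : well_shaped D st ->
  (offdiag st <= steps st ^ 2 * n)%N.
Proof.
move=> W; apply: leq_trans (offdiag_le W) _; rewrite mulnC leq_mul2r.
by case: (steps st) => [|k]; rewrite ?orbT //; have := bin2_double k; lia.
Qed.

Lemma lazy_worst_relax_best_counters D st : well_shaped D st ->
  lazy_worst st -> relax_best st -> (steps st < n)%N ->
  (steps st ^ 2 * n <= 6 * (offdiag st + M_diag st))%N /\
  (offdiag st + M_diag st <= 2 * (steps st ^ 2 * n))%N.
Proof.
move=> W worst relax kn; have := offdiag_le_square W.
rewrite (M_diag_relax_best W relax) (history_sum_worst predn W worst) add0n.
move: kn; set k := steps st => kn hi.
have := worst_sum_pred kn; have := worst_sum_le predn kn.
have k12 : (n * k <= n * k ^ 2)%N.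
  by have /andP[k12 _] := leq_powers k; rewrite leq_mul2l k12 orbT.
have : (k * k.+1 * (2 * k + 1) <= k * k.+1 * (2 * n))%N by rewrite leq_mul2l; lia.
have : (n * (2 * \sum_(2 <= j < k.+2) j.-1) = n * (k * k + k))%N.
  by rewrite -sum_pred [X in _ = (_ * (_ * X))%N]big_ltn.
by split; lia.
Qed.

Lemma lazy_worst_relax_worst_counters D st : well_shaped D st ->
  lazy_worst st -> relax_worst st -> (steps st < n)%N ->
  (steps st ^ 3 * n <= 24 * (offdiag st + M_diag st))%N /\
  (offdiag st + M_diag st <= 2 * (steps st ^ 3 * n))%N.
Proof.
move=> W worst relax kn; have := offdiag_le_square W.
rewrite (M_diag_relax_worst relax) (history_sum_worst (fun j => 'C(j, 2)) W worst).
rewrite add0n; move: kn; set k := steps st => kn hi.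
have := worst_sum_bin2 kn; have := worst_sum_le (fun j => 'C(j, 2)) kn.
have k12 : (n * k <= n * k ^ 3)%N /\ (n * k ^ 2 <= n * k ^ 3)%N.
  have /andP[k12 k23] := leq_powers k.
  by split; apply: leq_mul; rewrite // (leq_trans k12 k23).
have : (k * k.+1 * k.+2 * (3 * k + 1) <= k * k.+1 * k.+2 * (3 * n))%N.
  by rewrite leq_mul2l; lia.
have : (n * (6 * \sum_(2 <= j < k.+2) 'C(j, 2)) = n * (k ^ 3 + 3 * k ^ 2 + 2 * k))%N.
  by rewrite -sum_bin2 [X in _ = (_ * (_ * X))%N]big_ltn.
by split; lia.
Qed.

End Cases.

(** * The estimates of the theorem *)

Section Transfer.
Variables (R : realType) (c0 : R).
Hypothesis c0_gt0 : 0 < c0.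
Implicit Types e : execution R.

Lemma ln_nvert_ge0 e : admissible c0 e -> 0 <= ln (n_of e).
Proof.
move=> adm; rewrite ln_ge0 // /n_of -[1]/(1%:R) ler_nat.
exact: ltnW (admissible_nvert c0_gt0 adm).
Qed.

Lemma ln_nvert_le e : admissible c0 e -> ln (n_of e) <= nnz_of e / c0.
Proof.
move=> adm; have n_gt1 := admissible_nvert c0_gt0 adm.
have [_ _ dense] := adm.
apply: (@le_trans _ _ (n_of e)).
  by apply: ltW; apply: ln_sublinear; rewrite /n_of ltr0n ltnW.
by rewrite ler_pdivlMr // mulrC.
Qed.

Lemma counters_nat e : counters e =
  (offdiag (final e) + M_diag (final e) + nnz (rate (input e)))%N%:R.
Proof. by rewrite /counters M_offdiagE !natrD. Qed.

(** The constant 1 in the last bound stands for the iteration of index 1, which takes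
    place even if k = 0.  Its cost O(log n) is not covered by the logarithmic
    term, which vanishes for k = 0, but by nnz(K) >= c0 n >= c0 ln n. *)
Lemma Theta_plus_O_powers (P : execution R -> Prop) (main log : execution R -> nat) q :
  (forall e, P e -> admissible c0 e) ->
  (forall e, P e ->
     [/\ main e <= q.+1 * (offdiag (final e) + M_diag (final e)),
         offdiag (final e) + M_diag (final e) <= 2 * main e
       & weighted_iterations (final e) <= 2 * log e + 1]%N) ->
  Theta_plus_O P (@running_time R) (fun e => (main e)%:R + nnz_of e)
    (fun e => (log e)%:R * ln (n_of e)).
Proof.
move=> Padm bounds; apply: (Theta_plus_O_admissible c0_gt0 Padm).
  move=> e Pe; rewrite addr_ge0 //; split=> //.
  by rewrite mulr_ge0 // ln_nvert_ge0 //; apply: Padm.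
exists (q.+1%:R^-1), 2, (2 + 1 / c0); split; rewrite ?invr_gt0 //.
  by rewrite addr_gt0 // divr_gt0.
move=> e Pe; have [lo hi work] := bounds e Pe; have adm := Padm e Pe.
rewrite counters_nat; split.
- rewrite ler_pdivrMl // /nnz_of -natrD -natrM ler_nat mulnDr.
  by rewrite leq_add // leq_pmull.
- by rewrite /nnz_of -natrD -natrM ler_nat; lia.
have ln0 := ln_nvert_ge0 adm; have lnN := ln_nvert_le adm.
have workR : (weighted_iterations (final e))%:R <= 2 * (log e)%:R + 1 :> R.
  by rewrite -natrM natr1 ler_nat -addn1.
have : log_work e <= (2 * (log e)%:R + 1) * ln (n_of e) by rewrite ler_wpM2r.
have f0 : 0 <= (main e)%:R + nnz_of e by rewrite addr_ge0.
have m0 : 0 <= (main e)%:R / c0 by rewrite divr_ge0 // ltW.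
have g0 : 0 <= (log e)%:R * ln (n_of e) by rewrite mulr_ge0.
have g1 : 0 <= (log e)%:R * ln (n_of e) / c0 by rewrite divr_ge0 // ltW.
have -> : (2 + 1 / c0) * ((main e)%:R + nnz_of e + (log e)%:R * ln (n_of e)) =
  2 * ((main e)%:R + nnz_of e) + 2 * ((log e)%:R * ln (n_of e)) +
  (main e)%:R / c0 + nnz_of e / c0 + (log e)%:R * ln (n_of e) / c0 by ring.
rewrite mulrDl mul1r -mulrA; lra.
Qed.

Lemma log_workE e : admissible c0 e -> log_work e =
  \sum_(1 <= j < (steps (final e)).+2)
     j%:R * (num_iterations (final e) j)%:R * ln (n_of e).
Proof.
case=> _ exec _; have [W _ _ _ _] := execution_cost exec.
rewrite /log_work /weighted_iterations (history_sum id W) natr_sum mulr_suml.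
by apply: eq_bigr => j _; rewrite natrM [j%:R * _]mulrC.
Qed.

End Transfer.

Theorem theorem5p3 (R : realType) :
  (forall p : problem R, valid p ->
     exists (st : state R (nvert p)) (t : nat), executes st t) /\
  (forall c0 : R, 0 < c0 ->
   [/\ Theta_plus_O (admissible c0) (@running_time R)
         (fun e => M_offdiag (final e) + (M_diag (final e))%:R + nnz_of e)
         (fun e => \sum_(1 <= j < (steps (final e)).+2)
                      j%:R * (num_iterations (final e) j)%:R * ln (n_of e)),
       Theta_plus_O
         (fun e => admissible c0 e /\ lazy_best (final e))
         (@running_time R)
         (fun e => k_of e ^+ 3 + nnz_of e)
         (fun e => k_of e ^+ 2 * ln (n_of e)),
       Theta_plus_O
         (fun e => [/\ admissible c0 e, lazy_worst (final e)
                     & relax_best (final e)])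
         (@running_time R)
         (fun e => k_of e ^+ 2 * n_of e + nnz_of e)
         (fun e => k_of e ^+ 2 * n_of e * ln (n_of e))
     & Theta_plus_O
         (fun e => [/\ admissible c0 e, lazy_worst (final e)
                     & relax_worst (final e)])
         (@running_time R)
         (fun e => k_of e ^+ 3 * n_of e + nnz_of e)
         (fun e => k_of e ^+ 2 * n_of e * ln (n_of e))]).
Proof.
split=> [p|c0 c0_gt0]; first exact: termination.
have powers f g f' g' P : f =1 f' -> g =1 g' ->
    Theta_plus_O P (@running_time R) f g -> Theta_plus_O P (@running_time R) f' g'.
  by move=> /funext -> /funext ->.
split.
- apply: (Theta_plus_O_admissible c0_gt0) => // [e adm|].
    split; last first.
      by rewrite -(log_workE adm) mulr_ge0 // (ln_nvert_ge0 c0_gt0).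
    by rewrite -/(counters e) counters_nat.
  exists 1, 1, 1; split=> // e adm; rewrite !mul1r -(log_workE adm).
  by rewrite -/(counters e) counters_nat; split=> //; rewrite lerDr.
- apply: (powers (fun e => (steps (final e) ^ 3)%N%:R + nnz_of e)
                 (fun e => (steps (final e) ^ 2)%N%:R * ln (n_of e)));
    try by move=> e; rewrite /k_of natrX.
  apply: (Theta_plus_O_powers c0_gt0 (q := 5)) => e [adm best] //.
  have [_ exec _] := adm; have [W _ pot _ _] := execution_cost exec.
  by have [lo hi work] := lazy_best_counters W best pot; split=> //; lia.
- apply: (powers (fun e => (steps (final e) ^ 2 * nvert (input e))%N%:R + nnz_of e)
                 (fun e => (steps (final e) ^ 2 * nvert (input e))%N%:R * ln (n_of e)));
    try by move=> e; rewrite /k_of /n_of natrM natrX.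
  apply: (Theta_plus_O_powers c0_gt0 (q := 5)) => e [adm worst relax] //.
  have [_ exec _] := adm; have [W kn _ _ _] := execution_cost exec.
  have [lo hi] := lazy_worst_relax_best_counters W worst relax kn.
  by split=> //; apply: lazy_worst_weight W worst kn.
- apply: (powers (fun e => (steps (final e) ^ 3 * nvert (input e))%N%:R + nnz_of e)
                 (fun e => (steps (final e) ^ 2 * nvert (input e))%N%:R * ln (n_of e)));
    try by move=> e; rewrite /k_of /n_of natrM natrX.
  apply: (Theta_plus_O_powers c0_gt0 (q := 23)) => e [adm worst relax] //.
  have [_ exec _] := adm; have [W kn _ _ _] := execution_cost exec.
  have [lo hi] := lazy_worst_relax_worst_counters W worst relax kn.
  by split=> //; apply: lazy_worst_weight W worst kn.
Qed.
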